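(* Assume the setting described in the context (random geometric graph $G=G(r_n)$ with location density $f$ satisfying $\epsilon_1\le f\le\epsilon_2$ on $S$, i.i.d. edge weights with inverse ccdf $H$). Suppose there are constants $0<\beta<c<\frac12$ (strict inequalities) such that $$r_n\ge \frac{1}{n^{\beta}},\qquad q_n=\frac{1}{n^{c}},\qquad L_n:=\frac{\zeta_n}{r_n}\ge 1 .$$ Suppose also that $H(z)$ is strictly increasing for all large $z$. Then for every $\gamma,\kappa>0$ and for all sufficiently small $0<\varepsilon<1$ (i.e. there is $\varepsilon_0\in(0,1)$ such that for every $\varepsilon\in(0,\varepsilon_0)$), there are constants $\theta_1,\theta_2>0$, not depending on $n$, such that for all $n$ large $$\mathbb{P}\bigl(M_n(\theta_1L_n,q_n,w_n)\ge \theta_2L_n\alpha_n\bigr)\ge 1-\frac{1}{n^{1+\gamma}},$$ where $N:=nr_n^2$, $w_n:=H(N^{1-\varepsilon})$ and $$\alpha_n:=\begin{cases}H\!\left(\dfrac{N^2}{(\log n)^{1+\kappa}}\right), & L_n\le(\log n)^{1+\kappa},\\[2mm] H(N^2), & \text{otherwise.}\end{cases}$$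
   Context: Setting. Let $S=[-\frac12,\frac12]^2$ and let $f$ be a probability density on $S$ (not depending on $n$) with $\epsilon_1\le f(x)\le\epsilon_2$ for all $x\in S$, for some positive finite constants $\epsilon_1,\epsilon_2$. For each $n$, let $X_1,\dots,X_n$ be i.i.d. with density $f$; $X_v$ is the location of vertex $v\in\{1,\dots,n\}$. Add two deterministic vertices $O_1,O_2$ with locations $X_{O_1}=(0,0)$ and $X_{O_2}=(\zeta_n,0)$, where $0<\zeta_n<\frac12$ is a deterministic sequence. Let $K_n^{(2)}$ be the graph on $\{1,\dots,n\}\cup\{O_1,O_2\}$ whose edges are all pairs of distinct vertices of $\{1,\dots,n\}$ together with all pairs $(O_1,j),(O_2,j)$, $1\le j\le n$. For a deterministic sequence $0<r_n<1$, the random geometric graph $G=G(r_n)$ is the subgraph of $K_n^{(2)}$ formed by all edges $(u,v)$ with $d(X_u,X_v)<r_n$, where $d$ is Euclidean distance. Weights. The edges $h$ of $K_n^{(2)}$ carry i.i.d. weights $W(h)$, independent of the locations, with $0<W(h)<\infty$ a.s. and common law not depending on $n$. The ccdf is $F_c(x):=\mathbb{P}(W(h)>x)$, $x>0$, and the inverse ccdf is $H(z):=\sup\{x>0: F_c(x)\ge \frac1z\}$ for $z>1$, so $0<H(z)<\infty$. Paths. A path from $O_1$ to $O_2$ in $G$ is a sequence of distinct vertices $\Pi=(v_0=O_1,v_1,\dots,v_t=O_2)$ such that each $(v_i,v_{i+1})$, $0\le i\le t-1$, is an edge of $G$. For $l,q,w\ge0$, $\Pi$ is an $(l,q,w)$-path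 if it has at most $l$ edges ($t\le l$), $d(X_{v_i},X_{v_{i+1}})\ge q$ for all $0\le i\le t-1$, and $W(v_i,v_{i+1})\ge w$ for all $0\le i\le t-1$. Its weight is $W(\Pi)=\sum_{i=0}^{t-1}W(v_i,v_{i+1})$. $M_n(l,q,w)$ is the maximum weight of an $(l,q,w)$-path in $G$, with the maximum of the empty set equal to $0$. *)

(* Defs.v *)
From HB Require Import structures.
From mathcomp Require Import all_boot all_order all_algebra.
From mathcomp Require Import all_classical all_reals all_analysis.

Set Implicit Arguments.
Unset Strict Implicit.
Unset Printing Implicit Defensive.

Import Order.TTheory GRing.Theory Num.Theory.
Import numFieldNormedType.Exports.

Local Open Scope classical_set_scope.
Local Open Scope ring_scope.

Section Independence.
Context {d : measure_display} {T : measurableType d} {R : realType}.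
Variable P : probability T R.

Definition mutually_independent (I : finType) (D : {set I})
    (F : I -> set (set T)) : Prop :=
  forall (J : {set I}) (A : I -> set T), J \subset D ->
    (forall i, i \in J -> F i (A i)) ->
    P (\bigcap_(i in [set i | i \in J]) A i) = (\prod_(i in J) P (A i))%E.

Definition independent_classes (F G : set (set T)) : Prop :=
  forall A B, F A -> G B -> P (A `&` B) = (P A * P B)%E.

Definition sigma_of_family {d' : measure_display} {T' : measurableType d'}
    (I : finType) (D : {set I}) (Y : I -> T -> T') : set (set T) :=
  <<s \bigcup_(i in [set i | i \in D]) g_sigma_algebra_preimage (Y i) >>.

End Independence.

Section Graph.
Variable n : nat.

(* inl i is the i-th random vertex; the two added vertices are inr _. *)
Definition vertex : finType := ('I_n + bool)%type.
Definition O1 : vertex := inr false.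
Definition O2 : vertex := inr true.

(* Edges are unordered pairs; O1O2 is the only pair that is not an edge. *)
Definition K2_edges : {set {set vertex}} :=
  [set e : {set vertex} | (#|e| == 2)%N && (e != [set O1; O2])%SET]%SET.

End Graph.
Arguments O1 {n}.
Arguments O2 {n}.

Section Paths.
Context {R : realType}.

Definition unit_square : set (R * R) :=
  `[- 2^-1, 2^-1]%classic `*` `[- 2^-1, 2^-1]%classic.

Definition euclid_dist (x y : R * R) : R :=
  Num.sqrt ((x.1 - y.1) ^+ 2 + (x.2 - y.2) ^+ 2).

Variable n : nat.

Definition location (zeta : R) (X : 'I_n -> R * R) (v : vertex n) : R * R :=
  match v with
  | inl i => X i
  | inr false => (0, 0)
  | inr true => (zeta, 0)
  end.

Variables (r : R) (loc : vertex n -> R * R) (wt : {set vertex n} -> R).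

Definition rgg_adj : rel (vertex n) := fun u v =>
  ([set u; v]%SET \in K2_edges n) && (euclid_dist (loc u) (loc v) < r).

(* A path (O1, v_1, ..., v_t = O2) is represented by p = [:: v_1; ...; v_t],
   so that t = size p. *)
Definition rgg_path (p : seq (vertex n)) : bool :=
  [&& uniq (O1 :: p), last O1 p == O2 & path rgg_adj O1 p].

Definition lqw_path (l q w : R) (p : seq (vertex n)) : bool :=
  [&& rgg_path p, (size p)%:R <= l &
      path (fun u v => (q <= euclid_dist (loc u) (loc v)) &&
                       (w <= wt [set u; v]%SET)) O1 p].

Definition path_weight (p : seq (vertex n)) : R :=
  \sum_(e <- zip (O1 :: p) p) wt [set e.1; e.2]%SET.

(* There are finitely many paths, so that this supremum is a maximum (see
   max_weightP); it is 0 when there is no (l,q,w)-path (see max_weight0). *)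
Definition max_weight (l q w : R) : R :=
  sup [set path_weight p | p in [set p | lqw_path l q w p]].

Lemma max_weightP (l q w : R) : (exists p, lqw_path l q w p) ->
  exists2 p, lqw_path l q w p & max_weight l q w = path_weight p /\
    (forall p', lqw_path l q w p' -> path_weight p' <= path_weight p).
Proof.
move=> [p0 Hp0].
have sz p : lqw_path l q w p -> (size p <= #|vertex n|)%N.
  move=> /and3P[/and3P[+ _ _] _ _] => /card_uniqP Ep.
  by apply: (leq_trans (leqnSn _)); rewrite -[(size p).+1]Ep max_card.
pose b0 : (#|vertex n|).-bseq (vertex n) := Bseq (sz p0 Hp0).
case: (@arg_maxP _ _ _ b0 (fun b => lqw_path l q w (val b))
  (fun b => path_weight (val b)) Hp0) => b Hb bmax.
have pmax p' : lqw_path l q w p' -> path_weight p' <= path_weight (val b).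
  by move=> Hp'; exact: (bmax (Bseq (sz p' Hp'))).
exists (val b) => //; split=> //; apply/le_anti/andP; split.
- apply: ge_sup; first by exists (path_weight p0), p0.
  by move=> _ [p' Hp' <-]; exact: pmax.
- apply: ub_le_sup; last by exists (val b).
  by exists (path_weight (val b)) => _ [p' Hp' <-]; exact: pmax.
Qed.

Lemma max_weight0 (l q w : R) : (forall p, ~~ lqw_path l q w p) ->
  max_weight l q w = 0.
Proof.
move=> H; rewrite /max_weight (_ : [set p | _] = set0) ?image_set0 ?sup0 //.
by apply/seteqP; split=> // p /= Hp; move: (H p); rewrite Hp.
Qed.

End Paths.

Section Scales.
Context {R : realType}.

(* nu is the common law of the weights, so nu ]x, +oo[ = P(W > x). *)
Definition ccdf_of (nu : probability R R) (x : R) : \bar R :=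
  nu `]x, +oo[%classic.

Definition inv_ccdf (nu : probability R R) (z : R) : R :=
  sup [set x : R | 0 < x /\ ((z^-1)%:E <= ccdf_of nu x)%E].

Definition alpha_scale (H : R -> R) (kappa : R) (n : nat) (N L : R) : R :=
  let logk := (ln n%:R) `^ (1 + kappa) in
  if L <= logk then H (N ^+ 2 / logk) else H (N ^+ 2).

End Scales.

(* Main.v *)
(** Cut the segment from [O1] to [O2] into [l] consecutive cells of side about
[r], with gaps, so that any two points of neighbouring cells are at distance in
[[q, r)].  With overwhelming probability every cell contains at least [M], of
order [N = n r^2], vertices (Chernoff).  The path takes one vertex in each cell,
which makes it self-avoiding.

Conditionally on the cells of the vertices, two kinds of events matter, and both
are treated by union bounds over sets of vertices from
[P (no heavy edge in Q) <= exp (- p |Q|)]: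
- sets of [g^i] vertices of a cell have [g^(i+1)] neighbours by edges of weight at
  least [w] in the next and in the previous cell, where [g] is a small power of
  [N], and two sets of [g^K] vertices of consecutive cells are joined.  Growing
  such neighbourhoods from both ends links any two prescribed vertices that are
  [2K + 1] cells apart; since this is uniform in the two vertices, they may be
  chosen depending on the weights;
- between two consecutive links lies a bridge, the set of edges from the last cell
  of the first link to the first cell of the second one.  All (small [L]) or a
  positive fraction (large [L]) of the bridges contain an edge of weight at least
  [alpha], because a bridge has [M^2], of order [N^2], edges.
Linking these edges gives the path. *)

Require Import Defs.
From HB Require Import structures.
From mathcomp Require Import all_boot all_order all_algebra.
From mathcomp Require Import all_classical all_reals all_analysis.
From mathcomp Require Import zify ring lra.

Set Implicit Arguments.
Unset Strict Implicit.
Unset Printing Implicit Defensive.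

Import Order.TTheory GRing.Theory Num.Theory.
Import numFieldNormedType.Exports.

Local Open Scope classical_set_scope.
Local Open Scope ring_scope.

(** * Random finite sets *)

Section RealProbability.
Context {d : measure_display} {T : measurableType d} {R : realType}.
Variable P : probability T R.

Definition pr (E : set T) : R := fine (P E).

Lemma prE (E : set T) : measurable E -> P E = (pr E)%:E.
Proof. by move=> mE; rewrite /pr fineK// fin_num_measure. Qed.

Lemma pr_ge0 (E : set T) : 0 <= pr E.
Proof. by rewrite fine_ge0. Qed.

Lemma pr_setT : pr setT = 1.
Proof. by rewrite /pr probability_setT. Qed.

Lemma le_pr (A B : set T) : measurable A -> measurable B -> A `<=` B ->
  pr A <= pr B.
Proof. by move=> mA mB AB; rewrite -lee_fin -!prE// le_measure// inE. Qed.

Lemma pr_setC (A : set T) : measurable A -> pr (~` A) = 1 - pr A.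
Proof.
move=> mA; apply: EFin_inj.
by rewrite -prE ?probability_setC ?prE//; exact: measurableC.
Qed.

Lemma pr_setU_le (A B : set T) : measurable A -> measurable B ->
  pr (A `|` B) <= pr A + pr B.
Proof.
move=> mA mB; rewrite -lee_fin EFinD -!prE//; last exact: measurableU.
exact: measureU2.
Qed.

Lemma union_bound (I : finType) (C : pred I) (F : I -> set T) (E : set T) :
  measurable E -> (forall i, C i -> measurable (F i)) ->
  E `<=` \bigcup_(i in [set` C]) F i -> pr E <= \sum_(i | C i) pr (F i).
Proof.
move=> mE mF EF; rewrite -lee_fin -prE//.
apply: le_trans (@content_sub_fsum _ _ _ P _ _ _ _ finite_finset mF mE EF) _.
rewrite -(bigfs _ (r := index_enum I)) ?index_enum_uniq//; last first.
  by move=> i _; rewrite mem_index_enum.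
by rewrite -sumEFin; apply: lee_sum => i Ci; rewrite -(prE (mF i Ci)).
Qed.

Lemma union_bound_const (I : finType) (C : pred I) (F : I -> set T) (E : set T)
    (b : R) :
  measurable E -> (forall i, C i -> measurable (F i)) ->
  E `<=` \bigcup_(i in [set` C]) F i -> (forall i, C i -> pr (F i) <= b) ->
  pr E <= #|C|%:R * b.
Proof.
move=> mE mF EF Fb; apply: le_trans (union_bound mE mF EF) _.
by rewrite mulr_natl -sumr_const; exact: ler_sum.
Qed.

End RealProbability.

HB.instance Definition _ (I : finType) :=
  isPointed.Build {set I} (finset.set0 : {set I}).
HB.instance Definition _ (I : finType) :=
  @isMeasurable.Build default_measure_display {set I}
    discrete_measurable discrete_measurable0
    discrete_measurableC discrete_measurableU.

Section RandomSubset.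
Context {d : measure_display} {T : measurableType d} {R : realType}.
Variables (I : finType) (S : T -> {set I}).

Lemma measurable_fun_finset :
  (forall i, measurable [set t | i \in S t]) -> measurable_fun setT S.
Proof.
move=> mS _ Q _; rewrite setTI.
have -> : S @^-1` Q = \bigcup_(A in Q) \bigcap_i
    (if i \in A then [set t | i \in S t] else ~` [set t | i \in S t]).
  apply/seteqP; split=> t /=.
    by move=> QS; exists (S t) => // i _; case: ifPn => //= /negP.
  move=> [A QA SA]; suff -> : S t = A by [].
  apply/setP => i; have := SA i Logic.I.
  by case: ifPn => //= _ /negP/negbTE.
apply: fin_bigcup_measurable => [|A _]; first exact: finite_finset.
apply: fin_bigcap_measurable => [|i _]; first exact: finite_finset.
by case: ifP => // _; exact: measurableC.
Qed.

Hypothesis mS : measurable_fun setT S.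

Lemma measurable_preimage_finset (Q : set {set I}) : measurable (S @^-1` Q).
Proof. by rewrite -[X in measurable X]setTI; exact: mS. Qed.

Variable P : probability T R.

Definition law : probability {set I} R :=
  distribution P (mfun_Sub (mem_set mS)).

Lemma pr_law (Q : set {set I}) : pr law Q = pr P (S @^-1` Q).
Proof. by []. Qed.

End RandomSubset.

Lemma sum_pr_set1 (R : realType) (I : finType) (mu : probability {set I} R) :
  \sum_A pr mu [set A] = 1.
Proof.
apply: EFin_inj; rewrite -sumEFin -(probability_setT mu).
have -> : [set: {set I}] =
    \bigcup_(A in [set` [pred A : {set I} | true]]) [set A].
  by apply/seteqP; split=> // A _; exists A.
rewrite measure_fin_bigcup//=; last first.
  by apply/trivIsetP => A B _ _ /eqP AB; apply/seteqP; split=> C //= [->].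
rewrite -(bigfs _ (r := index_enum {set I})) ?index_enum_uniq//; last first.
  by move=> A _; rewrite mem_index_enum.
by apply: eq_bigr => A _; rewrite prE.
Qed.

Section JointEvent.
Context {d : measure_display} {T : measurableType d} {R : realType}.
Variables (P : probability T R) (I : finType) (Z : T -> {set I}).
Variables (B : {set I} -> set T) (Q : set {set I}).
Hypotheses (mZ : measurable_fun setT Z) (mB : forall z, measurable (B z)).

Definition joint_event : set T := [set t | Q (Z t) /\ B (Z t) t].

Let mZB z : measurable (Z @^-1` [set z] `&` B z).
Proof. by apply: measurableI => //; exact: measurable_preimage_finset. Qed.

Lemma joint_eventE : joint_event = \bigcup_(z in Q) (Z @^-1` [set z] `&` B z).
Proof.
apply/seteqP; split=> t; first by move=> [QZ BZ]; exists (Z t).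
by move=> [z Qz [/= Zt Bz]]; rewrite /joint_event/= Zt.
Qed.

Lemma measurable_joint_event : measurable joint_event.
Proof. by rewrite joint_eventE; exact: fin_bigcup_measurable. Qed.

Lemma pr_joint_event_le (b : R) :
  (forall z, P (Z @^-1` [set z] `&` B z) = P (Z @^-1` [set z]) * P (B z))%E ->
  0 <= b -> (forall z, Q z -> pr P (B z) <= b) -> pr P joint_event <= b.
Proof.
move=> indep b0 Qb.
apply: le_trans (@union_bound _ _ _ P _ (fun z => `[< Q z >])
  (fun z => Z @^-1` [set z] `&` B z) _ measurable_joint_event _ _) _ => //.
  by rewrite joint_eventE => t [z Qz ZB]; exists z => //; exact/asboolP.
rewrite -[leRHS]mul1r -(sum_pr_set1 (law mZ P)) mulr_suml.
apply: (@le_trans _ _ (\sum_(z | `[< Q z >]) pr (law mZ P) [set z] * b)).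
  apply: ler_sum => z /asboolP Qz; rewrite pr_law.
  suff -> : pr P (Z @^-1` [set z] `&` B z) =
      pr P (Z @^-1` [set z]) * pr P (B z) by rewrite ler_wpM2l ?pr_ge0// Qb.
  by apply: EFin_inj; rewrite EFinM -!prE//; exact: measurable_preimage_finset.
rewrite [leRHS](bigID (fun z => `[< Q z >]))/= ler_wpDr// sumr_ge0// => z _.
by rewrite mulr_ge0 ?pr_ge0.
Qed.

End JointEvent.

Lemma exists_subset_card (I : finType) (A : {set I}) (m : nat) :
  (m <= #|A|)%N -> exists2 B : {set I}, B \subset A & #|B| = m.
Proof.
move=> /card_geqP[s [us ss sA]]; exists [set x in s]%SET.
  by apply/fintype.subsetP => x; rewrite inE => /sA.
by rewrite cardsE -ss; exact/card_uniqP.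
Qed.

Lemma leq_card_bigcup_disjoint (I J : finType) (C : J -> {set I}) (B : {set J})
    (m : nat) :
  (forall i j, i != j -> [disjoint C i & C j]%B) ->
  (forall j, j \in B -> m <= #|C j|)%N ->
  (#|B| * m <= #|(\bigcup_(j in B) C j)%SET|)%N.
Proof.
move=> Cdisj Cm; pose F j := if j \in B then C j else finset.set0.
rewrite (_ : (\bigcup_(j in B) C j)%SET = (\bigcup_j F j)%SET) ?big_mkcond//.
rewrite -[leqRHS]sum1_card.
rewrite (@finset.partition_disjoint_bigcup _ _ _ _ addn)/=; last first.
  move=> i j ij; rewrite /F -!finset.setI_eq0.
  case: ifP => _; last by rewrite finset.set0I.
  by case: ifP => _; [rewrite finset.setI_eq0 Cdisj|rewrite finset.setI0].
rewrite -sum_nat_const big_mkcond/= leq_sum// => j _.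
by rewrite sum1_card /F; case: ifP => // /Cm.
Qed.

Section FiniteSetConcentration.
Context {R : realType}.
Variables (I : finType) (mu : probability {set I} R).

Definition product_law (p : I -> R) : Prop := forall A : {set I},
  pr mu [set A] = \prod_i (if i \in A then p i else 1 - p i).

(* Markov's inequality for [y ^- #|A|]. *)
Lemma product_law_lower_tail (p : I -> R) (a y : R) (m : nat) :
  product_law p -> (forall i, 0 <= p i <= 1) -> (forall i, a <= p i) ->
  1 <= y ->
  pr mu [set A : {set I} | (#|A| <= m)%N] <=
    y ^+ m * expR (- (#|I|%:R * a * (1 - y^-1))).
Proof.
move=> muE p01 ap y1; have y0 : 0 < y by exact: lt_le_trans y1.
have p0 i : 0 <= p i by have /andP[] := p01 i.
have q0 i : 0 <= 1 - p i by rewrite subr_ge0; have /andP[] := p01 i.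
have term0 (A : {set I}) : 0 <= \prod_i (if i \in A then p i / y else 1 - p i).
  by apply: prodr_ge0 => i _; case: ifP => // _; rewrite divr_ge0// ltW.
have tilt (A : {set I}) : pr mu [set A] =
    y ^+ #|A| * \prod_i (if i \in A then p i / y else 1 - p i).
  rewrite muE -prodr_const [X in _ = X * _]big_mkcond/= -big_split/=.
  apply: eq_bigr => i _; case: ifP => _; last by rewrite mul1r.
  by rewrite mulrC divfK// gt_eqF.
have markov : pr mu [set A : {set I} | (#|A| <= m)%N] <=
    y ^+ m * \prod_i (p i / y + (1 - p i)).
  apply: le_trans (@union_bound _ _ _ mu _ (fun A : {set I} => (#|A| <= m)%N)
    (fun A => [set A]) _ _ _ _) _ => //; first by move=> A Am; exists A.
  rewrite (@bigA_distr _ 0 1 *%R +%R)/= mulr_sumr.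
  rewrite [leRHS](bigID (fun A : {set I} => (#|A| <= m)%N))/= ler_wpDr//.
    by apply: sumr_ge0 => A _; rewrite mulr_ge0// exprn_ge0// ltW.
  apply: ler_sum => A Am; rewrite tilt ler_wpM2r//.
  by rewrite ler_weXn2l.
apply: le_trans markov _; rewrite ler_wpM2l ?exprn_ge0 ?(ltW y0)//.
apply: (@le_trans _ _ (\prod_(i : I) expR (- (a * (1 - y^-1))))).
  apply: ler_prod => i _; rewrite addr_ge0 ?divr_ge0 ?(ltW y0)//=.
  apply: le_trans (expR_ge1Dx _).
  have : a * (1 - y^-1) <= p i * (1 - y^-1).
    by rewrite ler_wpM2r// subr_ge0 invf_le1.
  lra.
by rewrite prodr_const -expRM_natl mulrN mulrA.
Qed.

Definition hitting_rate (D : {set I}) (p : R) : Prop :=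
  forall Q : {set I}, Q \subset D ->
    pr mu [set A : {set I} | [disjoint Q & A]%B] <= expR (- (p * #|Q|%:R)).

Lemma few_hits_le (J : finType) (C : J -> {set I}) (D : {set I}) (p : R)
    (m k : nat) :
  0 <= p -> hitting_rate D p ->
  (forall j, C j \subset D) -> (forall j, (m <= #|C j|)%N) ->
  (forall i j, i != j -> [disjoint C i & C j]%B) -> (k <= #|J|)%N ->
  pr mu [set A : {set I} | (#|[set j | ~~ [disjoint C j & A]]%SET| <= k)%N] <=
    'C(#|J|, k)%:R * expR (- (p * m%:R)) ^+ (#|J| - k).
Proof.
move=> p0 hit CD Cm Cdisj kJ; rewrite -bin_sub// -card_draws cardsE.
apply: union_bound_const => [//|//|A Ak|B /eqP BJ].
- have : (#|J| - k <= #|[set j | [disjoint C j & A]]%SET|)%N.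
    rewrite leq_subLR -(cardsC [set j | ~~ [disjoint C j & A]]%SET).
    rewrite leq_add// subset_leq_card//; apply/fintype.subsetP => j.
    by rewrite !inE negbK.
  move=> /exists_subset_card[B BA BJ]; exists B => /=; first exact/eqP.
  exact: BA.
apply: (@le_trans _ _ (pr mu [set A : {set I} |
    [disjoint (\bigcup_(j in B) C j)%SET & A]%B])).
  apply: le_pr => // A /= /fintype.subsetP BA; rewrite disjoint_sym.
  by apply/bigcup_disjointP => j /BA; rewrite inE disjoint_sym.
apply: le_trans (hit _ _) _.
  by apply/bigcupsP => j _; exact: CD.
rewrite -BJ -expRM_natl ler_expR mulrN lerN2 mulrCA ler_wpM2l// -natrM ler_nat.
by rewrite leq_card_bigcup_disjoint.
Qed.

End FiniteSetConcentration.

(** * Chains through a layered graph *)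

Section LayeredGraph.
Variables (V : finType) (E : {set {set V}}).

Definition adj : rel V := fun u v => [set u; v]%SET \in E.

Definition cross (A B : {set V}) : {set {set V}} :=
  [set [set u; v]%SET | u in A, v in B]%SET.

Definition neighbours (A Y : {set V}) : {set V} :=
  [set v in Y | [exists u in A, adj u v]]%SET.

Definition expands (a b : nat) (X Y : {set V}) : Prop :=
  forall A : {set V}, A \subset X -> #|A| = a -> (b <= #|neighbours A Y|)%N.

Definition joins (a : nat) (X Y : {set V}) : Prop :=
  forall A B : {set V}, A \subset X -> B \subset Y -> #|A| = a -> #|B| = a ->
    ~~ [disjoint cross A B & E].

Variables (D : nat -> {set V}) (g K l : nat).

(* The first and last layers may be too small for the expansion into them. *)
Definition expander : Prop :=
  [/\ forall k i, (k.+1 < l)%N -> (i < K)%N ->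
        expands (g ^ i) (g ^ i.+1) (D k) (D k.+1),
      forall k i, (0 < k < l)%N -> (i < K)%N ->
        expands (g ^ i) (g ^ i.+1) (D k.+1) (D k) &
      forall k, (0 < k)%N -> (k.+1 < l)%N -> joins (g ^ K) (D k) (D k.+1)].

Lemma adjC u v : adj u v = adj v u.
Proof. by rewrite /adj finset.setUC. Qed.

Lemma crossC (A B : {set V}) : cross A B = cross B A.
Proof.
by apply/setP => e; apply/imset2P/imset2P => -[u v uA vB ->];
  exists v u => //; rewrite finset.setUC.
Qed.

Lemma cross_adjP (A B : {set V}) :
  reflect (exists u v, [/\ u \in A, v \in B & adj u v])
    (~~ [disjoint cross A B & E]).
Proof.
apply: (iffP idP) => [/pred0Pn[e /andP[/imset2P[u v uA vB ->] uvE]]|].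
  by exists u, v.
move=> [u [v [uA vB uvE]]]; apply/pred0Pn; exists [set u; v]%SET.
by apply/andP; split=> //; exact: imset2_f.
Qed.

Definition chain (j k : nat) (x : nat -> V) : Prop :=
  (forall i, (j <= i <= k)%N -> x i \in D i) /\
  (forall i, (j <= i < k)%N -> adj (x i) (x i.+1)).

Definition splice (m : nat) (x y : nat -> V) (i : nat) : V :=
  if (i <= m)%N then x i else y i.

Definition linked (j k : nat) (u v : V) : Prop :=
  exists x, [/\ chain j k x, x j = u & x k = v].

Lemma splice_le m x y i : (i <= m)%N -> splice m x y i = x i.
Proof. by rewrite /splice => ->. Qed.

Lemma splice_gt m x y i : (m < i)%N -> splice m x y i = y i.
Proof. by rewrite /splice ltnNge => /negbTE->. Qed.

Lemma chain_splice j m k x y : chain j m x -> chain m.+1 k y ->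
  adj (x m) (y m.+1) -> chain j k (splice m x y).
Proof.
move=> [xD xE] [yD yE] xyE; split=> i ijk; have [im|mi] := leqP i m.
- by rewrite splice_le//; apply: xD; lia.
- by rewrite splice_gt//; apply: yD; lia.
- rewrite splice_le//; have [ilm|] := ltnP i m.
    by rewrite splice_le//; apply: xE; lia.
  by move=> mi; have -> : i = m by [lia]; rewrite splice_gt.
- by rewrite !splice_gt ?leqW//; apply: yE; lia.
Qed.

Lemma linked_refl k u : u \in D k -> linked k k u u.
Proof.
move=> uD; exists (fun=> u); split=> //; split=> i; last by lia.
by rewrite -eqn_leq => /eqP<-.
Qed.

Lemma linked_cat j m k u a b v : (j <= m)%N -> (m < k)%N ->
  linked j m u a -> adj a b -> linked m.+1 k b v -> linked j k u v.
Proof.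
move=> jm mk [x [xc xj xm]] ab [y [yc ym yk]]; exists (splice m x y); split.
- by apply: chain_splice => //; rewrite xm ym.
- by rewrite splice_le.
- by rewrite splice_gt.
Qed.

Lemma grow_forward j u i : u \in D j ->
  (forall h, (h < i)%N ->
    expands (g ^ h) (g ^ h.+1) (D (j + h)%N) (D (j + h).+1)) ->
  exists A : {set V}, [/\ A \subset D (j + i)%N, #|A| = (g ^ i)%N &
    {in A, forall v, linked j (j + i) u v}].
Proof.
move=> uD; elim: i => [|i IH] exp.
  exists [set u]%SET; rewrite addn0 finset.sub1set cards1; split=> // v.
  by move=> /finset.set1P->; exact: linked_refl.
have [h hi|A [AD As Alink]] := IH; first by apply: exp; lia.
have [B BN Bs] := exists_subset_card (exp i (leqnn _) A AD As).
have {}BN := fintype.subsetP BN.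
exists B; rewrite addnS; split=> //.
  by apply/fintype.subsetP => v /BN; rewrite inE => /andP[].
move=> v /BN; rewrite inE => /andP[vD /exists_inP[w wA wv]].
by apply: (linked_cat _ _ (Alink w wA) wv (linked_refl vD));
   rewrite ?leq_addr ?leqnn.
Qed.

Lemma grow_backward j v i : v \in D (j + i)%N ->
  (forall h, (h < i)%N ->
    expands (g ^ h) (g ^ h.+1) (D (j + i - h)%N) (D (j + i - h.+1)%N)) ->
  exists A : {set V}, [/\ A \subset D j, #|A| = (g ^ i)%N &
    {in A, forall u, linked j (j + i) u v}].
Proof.
elim: i j => [|i IH] j vD exp.
  rewrite addn0 in vD *; exists [set v]%SET; rewrite finset.sub1set cards1.
  by split=> // u /finset.set1P->; exact: linked_refl.
rewrite -addSnnS in vD exp.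
have [//|h hi|A [AD As Alink]] := IH j.+1; first by apply: exp; lia.
have := exp i (leqnn _); rewrite addnK addSnnS addnK => exp_i.
have [B BN Bs] := exists_subset_card (exp_i A AD As).
have {}BN := fintype.subsetP BN; exists B; split=> //.
  by apply/fintype.subsetP => u /BN; rewrite inE => /andP[].
move=> u /BN; rewrite inE => /andP[uD /exists_inP[w wA wu]]; rewrite adjC in wu.
rewrite -addSnnS; apply: (linked_cat _ _ (linked_refl uD) wu (Alink w wA)).
  exact: leqnn.
exact: leq_addr.
Qed.

(* Grow [g ^ K] vertices from each end in [K] steps, then join them. *)
Lemma expander_linked j u v : expander -> (0 < K)%N -> (j + K.*2.+1 <= l)%N ->
  u \in D j -> v \in D (j + K.*2.+1)%N -> linked j (j + K.*2.+1) u v.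
Proof.
move=> [fw bw join] K0 jl uD vD.
have [|A [AD As Alink]] := @grow_forward j u K uD.
  by move=> h hK; apply: fw; lia.
have kE : (j + K.*2.+1 = (j + K).+1 + K)%N by lia.
rewrite kE in vD *.
have [h hK|B [BD Bs Blink]] := grow_backward vD.
  have -> : ((j + K).+1 + K - h = ((j + K).+1 + K - h.+1).+1)%N by lia.
  by apply: bw => //; lia.
have /cross_adjP[a [b [aA bB ab]]] : ~~ [disjoint cross A B & E].
  by apply: join AD BD As Bs; lia.
by apply: (linked_cat _ _ (Alink a aA) ab (Blink b bB)); lia.
Qed.

(* The stage [j] consists of the layers from [j * c.+1] to [j * c.+1 + c]. *)
Lemma chain_stages (c J : nat) (a b : nat -> V) :
  (forall j, (j <= J)%N -> linked (j * c.+1) (j * c.+1 + c) (a j) (b j)) ->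
  (forall j, (j < J)%N -> adj (b j) (a j.+1)) ->
  exists x, chain 0 (J * c.+1 + c) x /\ forall j, (j <= J)%N ->
    x (j * c.+1)%N = a j /\ x (j * c.+1 + c)%N = b j.
Proof.
elim: J => [|J IH] link ba.
  have [x [xc xa xb]] := link 0 (leqnn _).
  by exists x; split=> // j; rewrite leqn0 => /eqP->.
have [j jJ|j jJ|x [xc xab]] := IH; [by apply: link; lia|by apply: ba; lia|].
have [y [yc ya yb]] := link J.+1 (leqnn _).
have startE : (J.+1 * c.+1 = (J * c.+1 + c).+1)%N by rewrite mulSn; lia.
exists (splice (J * c.+1 + c) x y); split.
  apply: chain_splice => //; rewrite -startE// ya (xab J _).2//.
  exact: ba.
move=> j; rewrite leq_eqVlt => /orP[/eqP->|jJ].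
  by rewrite !splice_gt ?ya ?yb// startE; lia.
have le_start : (j * c.+1 <= J * c.+1)%N by rewrite leq_mul2r -ltnS jJ orbT.
by rewrite !splice_le ?leq_add2r ?(leq_trans le_start) ?leq_addr//; exact: xab.
Qed.

End LayeredGraph.

(** * Random graphs *)

Lemma card_small_sets (V : finType) (m : nat) :
  (#|[set B : {set V} | (#|B| <= m)%N]%SET| <= #|V|.+1 ^ m)%N.
Proof.
pose f (g : {ffun 'I_m -> option V}) := [set v | Some v \in codom g]%SET.
apply: (@leq_trans #|f @: [set: {ffun 'I_m -> option V}]%SET|); last first.
  rewrite (leq_trans (leq_imset_card _ _))//.
  by rewrite cardsT card_ffun card_option card_ord.
apply/subset_leq_card/fintype.subsetP => B; rewrite inE => Bm.
apply/imsetP; exists [ffun i : 'I_m => onth (enum B) i]; rewrite ?inE//.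
apply/setP => v; rewrite inE; apply/idP/codomP => [vB|[i]].
  have vm : (index v (enum B) < m)%N.
    by rewrite (leq_trans _ Bm)// cardE index_mem mem_enum.
  exists (Ordinal vm); rewrite ffunE/=; apply/esym/eqP.
  by rewrite onthE (nth_map v) ?index_mem ?mem_enum// nth_index ?mem_enum.
rewrite ffunE => /esym iv; rewrite -(onth_nth v v (enum B) i iv).
by rewrite -mem_enum mem_nth// -onthTE iv.
Qed.

Lemma set2_inj_disjoint (V : finType) (A B : {set V}) (u u' v v' : V) :
  [disjoint A & B]%B -> u \in A -> u' \in A -> v \in B -> v' \in B ->
  [set u; v]%SET = [set u'; v']%SET -> u = u' /\ v = v'.
Proof.
move=> AB uA uA' vB vB' /setP uv; split.
  have := uv u; rewrite !finset.in_set2 eqxx/= => /esym/orP[/eqP//|/eqP uv'].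
  by have := disjointFr AB uA; rewrite uv' vB'.
have := uv v; rewrite !finset.in_set2 eqxx orbT => /esym/orP[/eqP vu'|/eqP//].
by have := disjointFr AB uA'; rewrite -vu' vB.
Qed.

Lemma card_cross (V : finType) (A B : {set V}) :
  [disjoint A & B]%B -> #|cross A B| = (#|A| * #|B|)%N.
Proof.
move=> AB; rewrite /cross curry_imset2X card_in_imset ?cardsX//.
move=> [u v] [u' v']; rewrite !finset.in_setX /= => /andP[uA vB] /andP[uA' vB'].
by move=> /(set2_inj_disjoint AB uA uA' vB vB')[-> ->].
Qed.

Section RandomGraph.
Context {R : realType}.
Variables (V : finType) (mu : probability {set {set V}} R).
Variables (edges : {set {set V}}) (p : R).
Hypotheses (p_ge0 : 0 <= p) (hit : hitting_rate mu edges p).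

Lemma no_cross_edge_le (A B : {set V}) (m : nat) :
  [disjoint A & B]%B -> cross A B \subset edges -> (m <= #|A| * #|B|)%N ->
  pr mu [set E : {set {set V}} | [disjoint cross A B & E]%B] <=
    expR (- (p * m%:R)).
Proof.
move=> AB ABe mAB; apply: le_trans (hit ABe) _.
by rewrite ler_expR lerN2 ler_wpM2l// ler_nat card_cross.
Qed.

Lemma small_pairs_union_bound (a b : nat) (C : pred ({set V} * {set V}))
    (F : {set V} * {set V} -> set {set {set V}}) (G : set {set {set V}})
    (x : R) :
  (forall AB, C AB -> (#|AB.1| <= a)%N && (#|AB.2| <= b)%N) ->
  G `<=` \bigcup_(AB in [set` C]) F AB -> 0 <= x ->
  (forall AB, C AB -> pr mu (F AB) <= x) ->
  pr mu G <= #|V|.+1%:R ^+ (a + b) * x.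
Proof.
move=> Cab GF x0 Fx; apply: le_trans (union_bound_const _ _ GF Fx) _ => //.
rewrite ler_wpM2r// -natrX ler_nat.
pose small m := [set B : {set V} | (#|B| <= m)%N]%SET.
apply: (@leq_trans #|finset.setX (small a) (small b)|).
  apply/subset_leq_card/fintype.subsetP => AB /Cab/andP[Aa Bb].
  by rewrite !inE Aa.
by rewrite cardsX expnD leq_mul// card_small_sets.
Qed.

Lemma expands_failure_le (X Y : {set V}) (a b M : nat) :
  [disjoint X & Y]%B -> cross X Y \subset edges -> (M <= #|Y|)%N ->
  pr mu [set E | ~ expands E a b X Y] <=
    #|V|.+1%:R ^+ (a + b) * expR (- (p * (a * (M - b))%:R)).
Proof.
move=> XY XYe MY.
apply: (small_pairs_union_bound
  (C := fun AB => [&& AB.1 \subset X, #|AB.1| == a & (#|AB.2| <= b)%N])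
  (F := fun AB => [set E : {set {set V}} |
    [disjoint cross AB.1 (Y :\: AB.2)%SET & E]%B])).
- by move=> AB /and3P[_ /eqP-> ->]; rewrite leqnn.
- move=> E /= /existsNP[A] /not_implyP[AX] /not_implyP[Aa] /negP.
  rewrite -ltnNge => Ab; exists (A, neighbours E A Y) => /=.
    by rewrite unfold_in/= AX Aa eqxx ltnW.
  apply/negPn/cross_adjP => -[u [v [uA + uv]]].
  by rewrite !inE => /andP[+ vY]; rewrite vY/= => /exists_inPn/(_ u uA)/negP.
- exact: expR_ge0.
move=> [A B] /and3P[/= AX /eqP Aa Bb]; apply: no_cross_edge_le.
- apply: disjointWl AX _; apply: disjointWr XY.
  by apply/fintype.subsetP => v; rewrite inE => /andP[].
- apply: fintype.subset_trans XYe; apply: imset2S => //.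
  by apply/fintype.subsetP => v; rewrite inE => /andP[].
rewrite Aa leq_mul2l cardsD leq_sub ?orbT// (leq_trans _ Bb)//.
by apply/subset_leq_card/fintype.subsetP => v; rewrite inE => /andP[].
Qed.

Lemma joins_failure_le (X Y : {set V}) (a : nat) :
  [disjoint X & Y]%B -> cross X Y \subset edges ->
  pr mu [set E | ~ joins E a X Y] <=
    #|V|.+1%:R ^+ (a + a) * expR (- (p * (a * a)%:R)).
Proof.
move=> XY XYe.
apply: (small_pairs_union_bound (C := fun AB =>
    [&& AB.1 \subset X, AB.2 \subset Y, #|AB.1| == a & #|AB.2| == a])
  (F := fun AB => [set E : {set {set V}} | [disjoint cross AB.1 AB.2 & E]%B])).
- by move=> AB /and4P[_ _ /eqP-> /eqP->]; rewrite leqnn.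
- move=> E /= /existsNP[A] /existsNP[B] /not_implyP[AX] /not_implyP[BY].
  move=> /not_implyP[Aa] /not_implyP[Ba] /negP/negPn AB.
  by exists (A, B) => //=; rewrite unfold_in/= AX BY Aa Ba eqxx.
- exact: expR_ge0.
move=> [A B] /and4P[/= AX BY /eqP Aa /eqP Ba]; apply: no_cross_edge_le.
- by apply: disjointWl AX _; apply: disjointWr BY _.
- by apply: fintype.subset_trans XYe; exact: imset2S.
- by rewrite Aa Ba.
Qed.

Variables (g K l M : nat) (lambda : R).
Hypotheses (g_gt0 : (0 < g)%N) (gM : (g ^ K <= M)%N) (lambda_ge0 : 0 <= lambda).
Let entropy : R := ln #|V|.+1%:R.
Hypothesis expand_rate :
  (1 + g%:R) * entropy + lambda <= p * (M%:R - g%:R ^+ K).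
Hypothesis join_rate : 2 * entropy + lambda <= p * g%:R ^+ K.

Lemma entropy_rate_le (s b m : nat) : (0 < s)%N ->
  b%:R * entropy + lambda <= p * m%:R ->
  #|V|.+1%:R ^+ (s * b) * expR (- (p * (s * m)%:R)) <= expR (- lambda).
Proof.
move=> s0 rate.
have -> : #|V|.+1%:R ^+ (s * b) = expR ((s * b)%:R * entropy) :> R.
  by rewrite expRM_natl lnK// posrE.
rewrite -expRD ler_expR !natrM; have s1 : 1 <= s%:R :> R by rewrite ler1n.
have := ler_wpM2l (le_trans ler01 s1) rate; have := ler_peMl lambda_ge0 s1; lra.
Qed.

Lemma expands_all_failure_le (C : pred nat) (X Y : nat -> {set V}) :
  (forall k, C k -> [/\ (k < l)%N, [disjoint X k & Y k]%B,
    cross (X k) (Y k) \subset edges & (M <= #|Y k|)%N]) ->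
  pr mu [set E | ~ forall k i, C k -> (i < K)%N ->
    expands E (g ^ i) (g ^ i.+1) (X k) (Y k)] <= (l * K)%:R * expR (- lambda).
Proof.
move=> CXY; pose C' (ki : 'I_l * 'I_K) := C ki.1.
apply: (@le_trans _ _ (#|C'|%:R * expR (- lambda))); last first.
  have <- : #|{: 'I_l * 'I_K}| = (l * K)%N by rewrite card_prod !card_ord.
  by rewrite ler_wpM2r ?expR_ge0// ler_nat max_card.
apply: (union_bound_const (F := fun ki : 'I_l * 'I_K => [set E |
  ~ expands E (g ^ ki.2) (g ^ ki.2.+1) (X ki.1) (Y ki.1)])) => //.
  move=> E /= /existsNP[k] /existsNP[i] /not_implyP[Ck] /not_implyP[iK] nE.
  by have [kl _ _ _] := CXY k Ck; exists (Ordinal kl, Ordinal iK).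
move=> [k i] /= /CXY[_ XY XYe MY].
apply: le_trans (expands_failure_le _ _ XY XYe MY) _.
have giK : (g * g ^ i <= g ^ K)%N by rewrite -expnS leq_pexp2l.
rewrite expnS -{1}[(g ^ i)%N]muln1 (mulnC g) -mulnDr.
apply: entropy_rate_le; first by rewrite expn_gt0 g_gt0.
rewrite natrD; apply: le_trans expand_rate _; rewrite ler_wpM2l//.
by rewrite natrB ?(leq_trans _ gM) 1?mulnC// lerB// -natrX ler_nat.
Qed.

Lemma joins_all_failure_le (C : pred nat) (X Y : nat -> {set V}) :
  (forall k, C k -> [/\ (k < l)%N, [disjoint X k & Y k]%B &
    cross (X k) (Y k) \subset edges]) ->
  pr mu [set E | ~ forall k, C k -> joins E (g ^ K) (X k) (Y k)] <=
    l%:R * expR (- lambda).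
Proof.
move=> CXY; pose C' (k : 'I_l) := C k.
apply: (@le_trans _ _ (#|C'|%:R * expR (- lambda))); last first.
  by rewrite ler_wpM2r ?expR_ge0// ler_nat -[leqRHS](card_ord l) max_card.
apply: (union_bound_const (F := fun k : 'I_l =>
  [set E | ~ joins E (g ^ K) (X k) (Y k)])) => //.
  move=> E /= /existsNP[k] /not_implyP[Ck] nE.
  by have [kl _ _] := CXY k Ck; exists (Ordinal kl).
move=> k /= /CXY[_ XY XYe]; apply: le_trans (joins_failure_le _ XY XYe) _.
rewrite addnn -muln2; apply: entropy_rate_le; first by rewrite expn_gt0 g_gt0.
by rewrite natrX.
Qed.

Lemma expander_failure_le (D : nat -> {set V}) :
  (forall k, (k < l)%N -> [disjoint D k & D k.+1]%B) ->
  (forall k, (k < l)%N -> cross (D k) (D k.+1) \subset edges) ->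
  (forall k, (0 < k < l)%N -> (M <= #|D k|)%N) ->
  pr mu [set E | ~ expander E D g K l] <=
    (l * K.*2.+1)%:R * expR (- lambda).
Proof.
move=> Ddisj Dedges DM.
have forward := @expands_all_failure_le (fun k => k.+1 < l)%N D (D \o S).
have backward := @expands_all_failure_le (fun k => 0 < k < l)%N (D \o S) D.
have joined :=
  @joins_all_failure_le (fun k => (0 < k)%N && (k.+1 < l)%N) D (D \o S).
apply: (@le_trans _ _ ((l * K)%:R * expR (- lambda) +
    (l * K)%:R * expR (- lambda) + l%:R * expR (- lambda))); last first.
  by rewrite -!mulrDl -!natrD ler_wpM2r ?expR_ge0// ler_nat; lia.
apply: le_trans (lerD (lerD (forward _) (backward _)) (joined _)); first last.
- by move=> k /andP[_ /ltnW kl]; split=> //; [exact: Ddisj|exact: Dedges].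
- move=> k kl; have /andP[k0 kl'] := kl; split=> //; last exact: DM.
    by rewrite disjoint_sym; exact: Ddisj.
  by rewrite crossC; exact: Dedges.
- move=> k kl; have kl' := ltnW kl.
  by split; [|exact: Ddisj|exact: Dedges|exact: DM].
apply: le_trans (lerD (pr_setU_le _ _ _) (lexx _)) => //.
apply: le_trans (pr_setU_le _ _ _) => //; apply: le_pr => // E /= nE.
apply: contrapT => /not_orP[/not_orP[/contrapT fw /contrapT bw] /contrapT join].
by apply: nE; split=> // k k0 kl; apply: join; rewrite k0.
Qed.

End RandomGraph.

(** * Cells and paths *)

Section Layers.
Variables (n l : nat).

(* [Z] records the pairs (vertex, cell) such that the cell contains the
   vertex. *)
Definition layer (Z : {set vertex n * 'I_l.+1}) (k : nat) : {set vertex n} :=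
  [set v | (v, inord k) \in Z]%SET.

Record layered (M : nat) (Z : {set vertex n * 'I_l.+1}) : Prop := Layered {
  layered_single : forall v k k', (v, k) \in Z -> (v, k') \in Z -> k = k';
  layered_O1 : O1 \in layer Z 0;
  layered_O2 : O2 \in layer Z l;
  layered_card : forall k, (0 < k < l)%N -> (M <= #|layer Z k|)%N }.

Variables (M : nat) (Z : {set vertex n * 'I_l.+1}).
Hypothesis Z_layered : layered M Z.

Lemma layer_inj v k k' : (k <= l)%N -> (k' <= l)%N ->
  v \in layer Z k -> v \in layer Z k' -> k = k'.
Proof.
move=> kl kl'; rewrite !inE => vk vk'.
have /(congr1 (@nat_of_ord _)) := layered_single Z_layered vk vk'.
by rewrite !inordK.
Qed.

Lemma layer_disjoint k : (k < l)%N -> [disjoint layer Z k & layer Z k.+1]%B.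
Proof.
move=> kl; apply/pred0Pn => -[v /andP[vk vk1]].
by have := layer_inj (ltnW kl) kl vk vk1; lia.
Qed.

Lemma layer_cross_disjoint i j : (i < l)%N -> (j < l)%N -> i != j ->
  [disjoint cross (layer Z i) (layer Z i.+1)
          & cross (layer Z j) (layer Z j.+1)]%B.
Proof.
move=> il jl ij; apply/pred0Pn => -[e /andP[]].
move=> /imset2P[u v ui vi ->] /imset2P[u' v' uj vj] /setP uv.
have := uv u; rewrite !finset.in_set2 eqxx/= => /esym/orP[] /eqP uE.
  rewrite -uE in uj; move: ij.
  by rewrite (layer_inj (ltnW il) (ltnW jl) ui uj) eqxx.
rewrite -uE in vj; have iE := layer_inj (ltnW il) jl ui vj.
have := uv v; rewrite !finset.in_set2 eqxx orbT => /esym/orP[] /eqP vE.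
  by rewrite -vE in uj; have := layer_inj il (ltnW jl) vi uj; lia.
by rewrite vE -uE in vi; have := layer_inj (ltnW il) il ui vi; lia.
Qed.

Hypothesis l_gt1 : (1 < l)%N.

Lemma layer_cross_edges k : (k < l)%N ->
  cross (layer Z k) (layer Z k.+1) \subset K2_edges n.
Proof.
move=> kl; apply/fintype.subsetP => _ /imset2P[u v uk vk ->].
have uv : u != v.
  by apply: contraTneq vk => <-; rewrite (disjointFr (layer_disjoint kl)).
rewrite inE cards2 uv/=; apply/eqP => /setP uvO.
have layerO i o : o \in layer Z i -> (i <= l)%N -> o \in [set u; v]%SET ->
    (i == k) || (i == k.+1).
  move=> oi il /finset.set2P[] oE; rewrite oE in oi.
    by rewrite (layer_inj il (ltnW kl) oi uk) eqxx.
  by rewrite (layer_inj il kl oi vk) eqxx orbT.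
have := layerO _ _ (layered_O1 Z_layered) (leq0n _).
have := layerO _ _ (layered_O2 Z_layered) (leqnn _).
rewrite !uvO !finset.in_set2 !eqxx orbT; lia.
Qed.

End Layers.

Section Cells.
Context {R : realType}.
Implicit Types (x y : R * R).

Definition cell (rho : R) (k : nat) : set (R * R) :=
  `[k%:R * rho, k%:R * rho + rho / 2]%classic `*` `[0, rho / 2]%classic.

Variable rho : R.
Hypothesis rho_gt0 : 0 < rho.

Lemma cellP k x : reflect
  [/\ k%:R * rho <= x.1, x.1 <= k%:R * rho + rho / 2, 0 <= x.2 & x.2 <= rho / 2]
  (x \in cell rho k).
Proof.
apply: (iffP idP); rewrite in_setE /cell/= !in_itv/=.
  by move=> [/andP[-> ->] /andP[-> ->]].
by move=> [-> -> -> ->].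
Qed.

Lemma measurable_cell k : measurable (cell rho k).
Proof. by apply: measurableX; exact: measurable_itv. Qed.

Lemma cell_inj k k' x : x \in cell rho k -> x \in cell rho k' -> k = k'.
Proof.
have le_index a b : x \in cell rho a -> x \in cell rho b -> (a <= b)%N.
  move=> /cellP[ax _ _ _] /cellP[_ xb _ _].
  rewrite -ltnS -(ltr_nat R) -natr1 -(ltr_pM2r rho_gt0) mulrDl mul1r.
  by move: rho_gt0; lra.
by move=> kx kx'; apply/eqP; rewrite eqn_leq !le_index.
Qed.

Lemma cell_dist (q r : R) k x y : q <= rho / 2 -> 2 * rho < r ->
  x \in cell rho k -> y \in cell rho k.+1 ->
  q <= euclid_dist x y /\ euclid_dist x y < r.
Proof.
move=> q_rho rho_r /cellP[x1 x2 x3 x4] /cellP[+ + y3 y4].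
rewrite -natr1 => y1 y2; have rho0 := rho_gt0.
have dx_ge : rho / 2 <= y.1 - x.1 by lra.
have dx_le : y.1 - x.1 <= 3 / 2 * rho by lra.
have dx2_ge : (rho / 2) ^+ 2 <= (x.1 - y.1) ^+ 2.
  by rewrite -[leRHS]sqrrN opprB lerXn2r ?nnegrE; lra.
have dx2_le : (x.1 - y.1) ^+ 2 <= (3 / 2 * rho) ^+ 2.
  by rewrite -[leLHS]sqrrN opprB lerXn2r ?nnegrE; lra.
have dy2_le : (x.2 - y.2) ^+ 2 <= (rho / 2) ^+ 2.
  rewrite -[leLHS]real_normK ?num_real// lerXn2r ?nnegrE//; first by lra.
  by rewrite ler_norml; apply/andP; split; lra.
have dy2_ge := sqr_ge0 (x.2 - y.2).
have r2 : (2 * rho) ^+ 2 < r ^+ 2 by rewrite ltr_pXn2r ?nnegrE//; lra.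
split.
  apply: (le_trans q_rho); rewrite -[leLHS]ger0_norm -?sqrtr_sqr; last by lra.
  by rewrite ler_wsqrtr//; lra.
rewrite -[ltRHS]ger0_norm -?sqrtr_sqr; last by lra.
by have rho2 := sqr_ge0 rho; rewrite ltr_sqrt; lra.
Qed.

Lemma cell_unit_square k : k.+1%:R * rho <= 2^-1 -> rho <= 2^-1 ->
  cell rho k `<=` unit_square.
Proof.
rewrite -natr1 mulrDl mul1r => kr r1 x xk.
have /cellP[x1 x2 x3 x4] : x \in cell rho k by rewrite in_setE.
have k0 : 0 <= k%:R * rho by rewrite mulr_ge0// ltW.
by rewrite /unit_square/= !in_itv/=; have := rho_gt0;
   split; apply/andP; split; lra.
Qed.

Lemma lebesgue_cell k : ((lebesgue_measure \x lebesgue_measure) (cell rho k) =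
  ((rho / 2) ^+ 2)%:E)%E.
Proof.
have itvE a b : a < b ->
    lebesgue_measure `[a, b]%classic = (b - a)%:E :> \bar R.
  by move=> ab; rewrite lebesgue_measure_itv/= lte_fin ab -EFinD.
have r20 : 0 < rho / 2 by rewrite divr_gt0.
rewrite /cell product_measure1E; try exact: measurable_itv.
rewrite expr2 EFinM; congr (_ * _)%E.
  by apply: (etrans (itvE _ _ _)); rewrite ?ltrDl// addrC addKr.
by apply: (etrans (itvE _ _ _)); rewrite ?subr0.
Qed.

Lemma cell_mass_ge (f : R * R -> R) (eps : R) k : 0 <= eps ->
  measurable_fun unit_square f -> (forall x, unit_square x -> eps <= f x) ->
  cell rho k `<=` unit_square ->
  ((eps * (rho / 2) ^+ 2)%:E <=
   \int[lebesgue_measure \x lebesgue_measure]_(x in cell rho k `&` unit_square)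
     (f x)%:E)%E.
Proof.
move=> e0 mf fe cS; rewrite (setIidl cS); have mc := measurable_cell k.
rewrite EFinM -(lebesgue_cell k) -integral_cst//; apply: ge0_le_integral => //.
- by apply/measurable_realfun.measurable_EFinP; apply: measurable_funS mf => //;
     apply: measurableX; exact: measurable_itv.
- by move=> x /cS/fe; rewrite lee_fin.
Qed.

End Cells.

Section PathsThroughCells.
Context {R : realType}.
Variables (n l M : nat) (rho : R).

Definition cell_pattern (loc : vertex n -> R * R) : {set vertex n * 'I_l.+1} :=
  [set vk : vertex n * 'I_l.+1 | loc vk.1 \in cell rho vk.2]%SET.

Lemma in_cell_pattern loc v k :
  ((v, k) \in cell_pattern loc) = (loc v \in cell rho k).
Proof. by rewrite finset.in_set. Qed.

Lemma layer_cell loc k v : (k <= l)%N ->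
  (v \in layer (cell_pattern loc) k) = (loc v \in cell rho k).
Proof. by move=> kl; rewrite finset.in_set in_cell_pattern inordK. Qed.

Variables (r q w theta : R).
Variables (loc : vertex n -> R * R) (wt : {set vertex n} -> R).
Hypotheses (rho_gt0 : 0 < rho) (rho_r : 2 * rho < r) (q_rho : q <= rho / 2).
Hypotheses (l_gt1 : (1 < l)%N) (l_theta : l%:R <= theta).
Hypothesis loc_layered : layered M (cell_pattern loc).
Variables (E : {set {set vertex n}}) (x : nat -> vertex n).
Hypothesis E_heavy : forall e, e \in E -> w <= wt e.
Hypothesis x_chain : chain E (layer (cell_pattern loc)) 0 l x.
Hypotheses (x0 : x 0 = O1) (xl : x l = O2).

Let p := [seq x j | j <- iota 1 l].

Let size_p : size p = l. Proof. by rewrite size_map size_iota. Qed.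

Let cons_p : O1 :: p = [seq x j | j <- iota 0 l.+1]. Proof. by rewrite -x0. Qed.

Let path_p (e : rel (vertex n)) :
  (forall j, (j < l)%N -> e (x j) (x j.+1)) -> path e O1 p.
Proof.
move=> xe; apply/(pathP O1) => j; rewrite size_p => jl.
rewrite cons_p !(nth_map 0%N) ?size_iota ?leqW// !nth_iota ?leqW//.
exact: xe.
Qed.

Lemma chain_lqw_path : lqw_path r loc wt theta q w p.
Proof.
have [xD xE] := x_chain.
have xcell j : (j <= l)%N -> loc (x j) \in cell rho j.
  by move=> jl; rewrite -layer_cell//; exact: xD.
have dist j : (j < l)%N -> q <= euclid_dist (loc (x j)) (loc (x j.+1)) /\
    euclid_dist (loc (x j)) (loc (x j.+1)) < r.
  by move=> jl; apply: cell_dist q_rho rho_r (xcell j (ltnW jl)) (xcell _ jl).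
apply/and3P; split; last 2 first.
- by rewrite size_p.
- apply: path_p => j jl; rewrite (dist j jl).1/=.
  by apply: E_heavy; exact: xE.
apply/and3P; split.
- rewrite cons_p map_inj_in_uniq ?iota_uniq// => i j.
  rewrite !mem_iota/= !add0n !ltnS.
  move=> il jl xij; apply: (layer_inj loc_layered il jl (xD i il)).
  by rewrite xij; exact: xD.
- rewrite (last_nth O1) cons_p size_p (nth_map 0%N) ?size_iota//.
  by rewrite nth_iota// xl.
- apply: path_p => j jl; rewrite /rgg_adj (dist j jl).2 andbT.
  apply: (fintype.subsetP (layer_cross_edges loc_layered l_gt1 jl)).
  by apply: imset2_f; apply: xD; lia.
Qed.

Lemma chain_path_weight :
  path_weight wt p = \sum_(j < l) wt [set x j; x j.+1]%SET.
Proof.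
have zip_p a m : zip [seq x j | j <- iota a m.+1] [seq x j | j <- iota a.+1 m] =
    [seq (x j, x j.+1) | j <- iota a m].
  by elim: m a => //= m IH a; rewrite -IH.
by rewrite /path_weight cons_p zip_p big_map -{1}[l]subn0 big_mkord.
Qed.

Lemma max_weight_ge_chain : \sum_(j < l) wt [set x j; x j.+1]%SET <=
  max_weight r loc wt theta q w.
Proof.
have [p' _ [-> pmax]] := max_weightP (ex_intro _ p chain_lqw_path).
by rewrite -chain_path_weight; exact: pmax chain_lqw_path.
Qed.

End PathsThroughCells.

Lemma cell_pattern_layered (R : realType) (n l M : nat) (rho zeta : R)
    (X : 'I_n -> R * R) :
  0 < rho -> zeta = l%:R * rho ->
  (forall k, (0 < k < l)%N -> (M <= #|[set i | X i \in cell rho k]%SET|)%N) ->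
  layered M (cell_pattern l rho (location zeta X)).
Proof.
move=> rho_gt0 zetaE XM; split.
- move=> v k k'; rewrite !in_cell_pattern => vk /(cell_inj rho_gt0 vk).
  exact: val_inj.
- by rewrite layer_cell//; apply/cellP; rewrite ?lexx/=; split; lra.
- by rewrite layer_cell// zetaE; apply/cellP => /=; split; lra.
move=> k kl; apply: leq_trans (XM k kl) _.
have inl_inj : injective (fun i : 'I_n => inl i : vertex n) by move=> i j [].
rewrite -(card_imset _ inl_inj); apply/subset_leq_card/fintype.subsetP => v.
move=> /imsetP[i]; rewrite finset.in_set => ik ->; rewrite layer_cell//.
by apply: ltnW; have /andP[] := kl.
Qed.

(** * Stages and bridges *)

Definition stage_end (K j : nat) : nat := j * K.*2.+2 + K.*2.+1.

Definition bridge (n l K : nat) (Z : {set vertex n * 'I_l.+1}) (j : nat) :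
    {set {set vertex n}} :=
  cross (layer Z (stage_end K j)) (layer Z (stage_end K j).+1).

Lemma stage_end_gt1 K J : (0 < K)%N -> (1 < stage_end K J)%N.
Proof. by rewrite /stage_end; lia. Qed.

Lemma stage_end_lt K J j : (0 < K)%N -> (j < J)%N ->
  ((stage_end K j).+1 < stage_end K J)%N.
Proof.
move=> K0 jJ; have : (j.+1 * K.*2.+2 <= J * K.*2.+2)%N.
  by rewrite leq_mul2r jJ orbT.
by rewrite /stage_end mulSn; lia.
Qed.

Lemma sum_ge_heavy (R : realType) (l J : nat) (f : nat -> R) (h : nat -> nat)
    (H : {set 'I_J}) (a : R) :
  (forall j, (j < l)%N -> 0 <= f j) -> injective h ->
  (forall j, (j < J)%N -> (h j < l)%N) ->
  (forall j : 'I_J, j \in H -> a <= f (h j)) ->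
  #|H|%:R * a <= \sum_(j < l) f j.
Proof.
move=> f0 h_inj h_lt fH.
pose h' (j : 'I_J) : 'I_l := Ordinal (h_lt j (ltn_ord j)).
have h'_inj : injective h'.
  by move=> i j /(congr1 (@nat_of_ord _))/=/h_inj; exact: val_inj.
rewrite (bigID (fun j => j \in h' @: H))/= ler_wpDr//.
  by apply: sumr_ge0 => j _; exact: f0.
rewrite big_imset/=; last by move=> i j _ _; exact: h'_inj.
by rewrite mulr_natl -sumr_const; exact: ler_sum.
Qed.

Section StagedPath.
Context {R : realType}.
Variables (n K J M g : nat).
Let l := stage_end K J.
Variables (Z : {set vertex n * 'I_l.+1}) (Ew Ea : {set {set vertex n}}).
Hypotheses (K_gt0 : (0 < K)%N) (gM : (g ^ K <= M)%N).
Hypothesis Z_layered : layered M Z.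
Hypothesis Ew_expander : expander Ew (layer Z) g K l.
Hypothesis EaEw : Ea \subset Ew.

Lemma bridge_endpoints j : (j < J)%N -> exists u v,
  [/\ u \in layer Z (stage_end K j), v \in layer Z (stage_end K j).+1,
    adj Ew u v & ~~ [disjoint bridge K Z j & Ea] -> adj Ea u v].
Proof.
move=> jJ; have end_lt := stage_end_lt K_gt0 jJ.
have [hit|nohit] := boolP (~~ [disjoint bridge K Z j & Ea]).
  have /cross_adjP[u [v [uD vD uv]]] := hit; exists u, v; split=> //.
  exact: (fintype.subsetP EaEw).
have in_range : (0 < stage_end K j < l)%N.
  by rewrite (ltnW end_lt) andbT /stage_end addnS.
have ZM := layered_card Z_layered.
have [A AD As] := exists_subset_card (leq_trans gM (ZM _ in_range)).
have [B BD Bs] :=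
  exists_subset_card (leq_trans gM (ZM (stage_end K j).+1 end_lt)).
have [_ _ join] := Ew_expander.
have /cross_adjP[u [v [uA vB uv]]] : ~~ [disjoint cross A B & Ew].
  by apply: join AD BD As Bs => //; have /andP[] := in_range.
exists u, v; split=> //; first exact: (fintype.subsetP AD).
exact: (fintype.subsetP BD).
Qed.

Lemma chain_over_bridges : exists x,
  [/\ chain Ew (layer Z) 0 l x, x 0 = O1, x l = O2 &
    forall j, (j < J)%N -> ~~ [disjoint bridge K Z j & Ea] ->
      adj Ea (x (stage_end K j)) (x (stage_end K j).+1)].
Proof.
have /choice[uv uvP] : forall j, exists uv : vertex n * vertex n, (j < J)%N ->
    [/\ uv.1 \in layer Z (stage_end K j), uv.2 \in layer Z (stage_end K j).+1,
      adj Ew uv.1 uv.2 & ~~ [disjoint bridge K Z j & Ea] -> adj Ea uv.1 uv.2].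
  move=> j; have [jJ|] := ltnP j J; last by exists (O1, O1); lia.
  by have [u [v uvP]] := bridge_endpoints jJ; exists (u, v).
pose a j := if j is j'.+1 then (uv j').2 else O1.
pose b j := if (j < J)%N then (uv j).1 else O2.
have endS j : (j.+1 * K.*2.+2 = (stage_end K j).+1)%N.
  by rewrite /stage_end mulSn; lia.
have [||x [xc xab]] := @chain_stages _ Ew (layer Z) K.*2.+1 J a b.
- move=> j jJ; have end_le : (stage_end K j <= l)%N.
    by rewrite leq_add2r leq_mul2r jJ orbT.
  apply: (expander_linked Ew_expander K_gt0 end_le).
    case: j jJ {end_le} => [|j] jJ; first exact: layered_O1 Z_layered.
    by rewrite endS; have [] := uvP j jJ.
  rewrite /b; case: ltnP => [|Jj]; first by case/uvP.
  by have -> : j = J by [lia]; exact: layered_O2 Z_layered.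
- by move=> j jJ; rewrite /b jJ; have [] := uvP j jJ.
exists x; split=> //; first by have [] := xab 0 (leq0n _).
  by have [_] := xab J (leqnn _); rewrite /b ltnn.
move=> j jJ hit; have [_ ->] := xab j (ltnW jJ); rewrite -endS.
have [-> _] := xab j.+1 jJ; rewrite /b jJ.
by have [_ _ _] := uvP j jJ; apply.
Qed.

Variables (rho r q w alpha theta : R) (k : nat).
Variables (loc : vertex n -> R * R) (wt : {set vertex n} -> R).
Hypotheses (rho_gt0 : 0 < rho) (rho_r : 2 * rho < r) (q_rho : q <= rho / 2).
Hypotheses (l_theta : l%:R <= theta) (w_ge0 : 0 <= w) (alpha_ge0 : 0 <= alpha).
Hypotheses (Ew_wt : forall e, e \in Ew -> w <= wt e)
  (Ea_wt : forall e, e \in Ea -> alpha <= wt e).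

Lemma max_weight_ge_bridges : Z = cell_pattern l rho loc ->
  (k < #|[set j : 'I_J | ~~ [disjoint bridge K Z j & Ea]]%SET|)%N ->
  k.+1%:R * alpha <= max_weight r loc wt theta q w.
Proof.
move=> ZE kH; have [x [xc x0 xl xEa]] := chain_over_bridges.
have l_gt1 := stage_end_gt1 J K_gt0.
have loc_layered : layered M (cell_pattern l rho loc) by rewrite -ZE.
rewrite ZE in xc; apply: le_trans (max_weight_ge_chain rho_gt0 rho_r q_rho l_gt1
  l_theta loc_layered Ew_wt xc x0 xl).
apply: (@le_trans _ _
  (#|[set j : 'I_J | ~~ [disjoint bridge K Z j & Ea]]%SET|%:R * alpha)).
  by rewrite ler_wpM2r// ler_nat.
apply: (@sum_ge_heavy R l J (fun j => wt [set x j; x j.+1]%SET) (stage_end K)).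
- by move=> j jl; apply: (le_trans w_ge0); apply: Ew_wt; exact: xc.2.
- by move=> i j /addIn/eqP; rewrite eqn_mul2r => /orP[//|/eqP].
- by move=> j jJ; exact: ltnW (stage_end_lt K_gt0 jJ).
- by move=> j; rewrite inE => hit; apply: Ea_wt; exact: xEa hit.
Qed.

End StagedPath.

(** * Locations and weights *)

Section Selection.
Context {d : measure_display} {T : measurableType d} {R : realType}.
Context {d' : measure_display} {U : measurableType d'}.
Variables (P : probability T R) (I : finType) (D : {set I}).
Variables (Y : I -> {RV P >-> U}) (B : set U).

Definition selected (t : T) : {set I} := [set i in D | Y i t \in B]%SET.

Lemma in_selected i t : (i \in selected t) = (i \in D) && (Y i t \in B).
Proof. by rewrite inE. Qed.

Lemma sigma_of_family_measurable (A : set T) :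
  sigma_of_family D (fun i => Y i : T -> U) A -> measurable A.
Proof.
apply: smallest_sub; first exact: sigma_algebra_measurable.
by move=> _ [i _ [C mC <-]]; rewrite setTI; exact: measurable_funPTI.
Qed.

Lemma sigma_of_family_finset (J : finType) (S : T -> {set J})
    (Q : set {set J}) :
  (forall j, sigma_of_family D (fun i => Y i : T -> U) [set t | j \in S t]) ->
  sigma_of_family D (fun i => Y i : T -> U) (S @^-1` Q).
Proof.
move=> mS; apply: (@measurable_preimage_finset _ (g_sigma_algebraType _) _ S).
exact: measurable_fun_finset.
Qed.

Hypothesis mB : measurable B.

Lemma sigma_preimage i :
  i \in D -> sigma_of_family D (fun i => Y i : T -> U) (Y i @^-1` B).
Proof.
move=> iD; apply: sub_sigma_algebra; exists i => //.
by exists B; rewrite ?setTI.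
Qed.

Lemma sigma_selected (Q : set {set I}) :
  sigma_of_family D (fun i => Y i : T -> U) (selected @^-1` Q).
Proof.
apply: sigma_of_family_finset => i; have [iD|iD] := boolP (i \in D).
  rewrite (_ : mkset _ = Y i @^-1` B); first exact: sigma_preimage.
  by apply/seteqP; split=> t /=; rewrite in_selected iD/= in_setE.
rewrite (_ : mkset _ = set0); first exact: sigma_algebra0.
by apply/seteqP; split=> t //=; rewrite in_selected (negbTE iD).
Qed.

Lemma measurable_selected : measurable_fun setT selected.
Proof.
move=> _ Q _; rewrite setTI.
exact: sigma_of_family_measurable (sigma_selected Q).
Qed.

Hypothesis indep :
  mutually_independent P D (fun i => g_sigma_algebra_preimage (Y i)).

Lemma pr_indep (J : {set I}) (A : I -> set T) : J \subset D ->
  (forall i, i \in J -> g_sigma_algebra_preimage (Y i) (A i)) ->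
  pr P (\bigcap_(i in [set i | i \in J]) A i) = \prod_(i in J) pr P (A i).
Proof.
move=> JD AY; have mA i : i \in J -> measurable (A i).
  by case/AY => C mC <-; rewrite setTI; exact: measurable_funPTI.
apply: EFin_inj; rewrite -prodEFin -prE; last exact: fin_bigcap_measurable.
by rewrite indep//; apply: eq_bigr => i iJ; rewrite -prE//; exact: mA.
Qed.

Let sigma_Y (C : set U) i : measurable C ->
  g_sigma_algebra_preimage (Y i) (Y i @^-1` C).
Proof. by move=> mC; exists C; rewrite ?setTI. Qed.

Lemma selected_hitting_rate (p : R) :
  (forall i, i \in D -> p <= pr P (Y i @^-1` B)) ->
  hitting_rate (law measurable_selected P) D p.
Proof.
move=> pY Q /fintype.subsetP QD; rewrite pr_law.
have mY i : measurable (Y i @^-1` B) by exact: measurable_funPTI.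
have -> : selected @^-1` [set A : {set I} | [disjoint Q & A]%B] =
    \bigcap_(i in [set i | i \in Q]) Y i @^-1` (~` B).
  apply/seteqP; split=> t /=.
    move=> QS i iQ /=; have /negbT := disjointFr QS iQ.
    by rewrite in_selected QD//= notin_setE.
  move=> QB; rewrite disjoint_subset; apply/fintype.subsetP => i iQ.
  by rewrite inE in_selected QD//= notin_setE; exact: QB.
rewrite pr_indep; first last.
- by move=> i _; apply: sigma_Y; exact: measurableC.
- exact/fintype.subsetP.
rewrite -mulNr mulrC expRM_natl -prodr_const.
apply: ler_prod => i iQ; rewrite pr_ge0 andTb preimage_setC (pr_setC P (mY i)).
by apply: le_trans (expR_ge1Dx _); rewrite lerD2l lerN2 pY ?QD.
Qed.

Lemma selected_product_law : D = [set: I]%SET ->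
  product_law (law measurable_selected P) (fun i => pr P (Y i @^-1` B)).
Proof.
move=> DT A; rewrite pr_law.
have mY i : measurable (Y i @^-1` B) by exact: measurable_funPTI.
pose C i := if i \in A then B else ~` B.
have -> : selected @^-1` [set A] =
    \bigcap_(i in [set i | i \in [set: I]%SET]) Y i @^-1` C i.
  apply/seteqP; split=> t /=.
    move=> SA i _; rewrite /C/= -SA in_selected DT finset.in_setT/=.
    by case: ifPn => [|/negP]; rewrite in_setE.
  move=> AC; apply/setP => i; have := AC i (finset.in_setT i).
  rewrite /C/= in_selected DT finset.in_setT/=; case: ifPn => _ Yi.
    exact: mem_set.
  by apply/negbTE; rewrite notin_setE.
rewrite pr_indep ?DT//; last first.
  move=> i _; apply: sigma_Y; rewrite /C; case: ifP => _ //.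
  exact: measurableC.
apply: eq_big => [i|i _]; first by rewrite finset.in_setT.
by rewrite /C; case: ifP => // _; rewrite preimage_setC (pr_setC P (mY i)).
Qed.

End Selection.

Section InverseCcdf.
Context {R : realType} (nu : probability R R).

Lemma closed_tail_ge (a : R) (b : \bar R) :
  (forall x, x < a -> (b <= ccdf_of nu x)%E) -> (b <= nu `[a, +oo[%classic)%E.
Proof.
move=> bnu; pose F (m : nat) : set R := `]a - m.+1%:R^-1, +oo[%classic.
have -> : `[a, +oo[%classic = \bigcap_m F m.
  apply/seteqP; split=> x /=.
    rewrite in_itv/= andbT => ax m _; rewrite /F/= in_itv/= andbT.
    by rewrite (lt_le_trans _ ax)// ltrBlDr ltrDl invr_gt0.
  move=> Fx; rewrite in_itv/= andbT; apply/ler_addgt0Pr => e e0.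
  have [m _ me] := near_infty_natSinv_lt (PosNum e0).
  have := Fx m Logic.I; rewrite /F/= in_itv/= andbT ltrBlDr => /ltW ax.
  by rewrite (le_trans ax)// lerD2l ltW// me/=.
have Fcvg : (nu \o F) x @[x --> \oo] --> nu (\bigcap_m F m).
  apply: nonincreasing_cvg_mu.
  - have := fin_num_measure nu (F 0%N) (measurable_itv _).
    by rewrite fin_numElt => /andP[].
  - by move=> m; exact: measurable_itv.
  - by apply: bigcapT_measurable => m; exact: measurable_itv.
  - move=> i j ij; rewrite subsetEset => x; rewrite /F/= !in_itv/= !andbT.
    by apply: le_lt_trans; rewrite lerB// lef_pV2 ?posrE// ler_nat.
rewrite -(cvg_lim _ Fcvg)//; apply: lime_ge.
  by apply/cvg_ex; eexists; exact: Fcvg.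
by near=> m; apply: bnu; rewrite ltrBlDr ltrDl invr_gt0.
Unshelve. all: by end_near. Qed.

Lemma inv_ccdf_ge0 (z : R) : 0 <= inv_ccdf nu z.
Proof.
rewrite /inv_ccdf; set A := mkset _.
have [hs|/sup_out->//] := pselect (has_sup A).
have [[x Ax] ub] := hs; apply: le_trans (ub_le_sup ub Ax).
by case: Ax => /ltW.
Qed.

Lemma inv_ccdf_tail (z : R) : 0 < inv_ccdf nu z ->
  ((z^-1)%:E <= nu `[inv_ccdf nu z, +oo[%classic)%E.
Proof.
rewrite /inv_ccdf; set A := mkset _ => supA0.
have hs : has_sup A.
  by apply: contrapT => /sup_out A0; rewrite A0 ltxx in supA0.
apply: closed_tail_ge => x xA; have xA0 : 0 < sup A - x by rewrite subr_gt0.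
have [y [_ zy]] := sup_adherent xA0 hs; rewrite subKr => xy.
apply: le_trans zy _.
apply: le_measure; rewrite ?inE; try exact: measurable_itv.
by move=> v; rewrite /= !in_itv/= !andbT; exact: lt_trans.
Qed.

End InverseCcdf.

Lemma size_lqw_path (R : realType) (n : nat) (r l q w : R)
    (loc : vertex n -> R * R) (wt : {set vertex n} -> R) (p : seq (vertex n)) :
  lqw_path r loc wt l q w p -> (size p <= #|vertex n|)%N.
Proof.
move=> /and3P[/and3P[/card_uniqP O1p _ _] _ _].
by apply: ltnW; rewrite -[(size p).+1]O1p max_card.
Qed.

Section MeasurableMaxWeight.
Context {d : measure_display} {T : measurableType d} {R : realType}.
Variables (P : probability T R) (n : nat).
Variables (X : 'I_n -> {RV P >-> (R * R)%type}).
Variables (W : {set vertex n} -> {RV P >-> R}).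
Variables (zeta r q w theta : R).

Let loc (t : T) := location zeta (fun i => X i t).
Let wt (t : T) := fun e => W e t.

Lemma measurable_location u : measurable_fun setT (fun t => loc t u).
Proof.
by case: u => [i|[]]; [exact: measurable_funPT|exact: measurable_cst..].
Qed.

Lemma measurable_euclid_dist u v :
  measurable_fun setT (fun t => euclid_dist (loc t u) (loc t v)).
Proof.
have coord (f : R * R -> R) a : measurable_fun setT f ->
    measurable_fun setT (fun t => f (loc t a)).
  by move=> mf; exact: measurableT_comp mf (measurable_location a).
have msqrt : measurable_fun setT (Num.sqrt : R -> R).
  apply: measurable_realfun.continuous_measurable_fun.
  exact: sqrt_continuous.
have msqr : measurable_fun setT (fun t =>
    ((loc t u).1 - (loc t v).1) ^+ 2 + ((loc t u).2 - (loc t v).2) ^+ 2).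
  by apply: measurable_realfun.measurable_funD;
     apply: measurable_realfun.measurable_funX;
     apply: measurable_realfun.measurable_funB; exact: coord.
exact: measurableT_comp msqrt msqr.
Qed.

Lemma measurable_fun_path (V : Type) (e : T -> rel V) x p :
  (forall u v, measurable_fun setT (fun t => e t u v)) ->
  measurable_fun setT (fun t => path (e t) x p).
Proof.
move=> me; elim: p x => [|y p IH] x /=; first exact: measurable_cst.
exact: measurable_and.
Qed.

Lemma measurable_lqw_path p :
  measurable_fun setT (fun t => lqw_path r (loc t) (wt t) theta q w p).
Proof.
have mdist := measurable_euclid_dist; have mcst := @measurable_cst.
rewrite /lqw_path /rgg_path.
apply: measurable_and; repeat apply: measurable_and => //.
  apply: measurable_fun_path => u v; apply: measurable_and => //.
  exact: measurable_realfun.measurable_fun_ltr.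
apply: measurable_fun_path => u v.
by apply: measurable_and; exact: measurable_realfun.measurable_fun_ler.
Qed.

Lemma measurable_path_weight p :
  measurable_fun setT (fun t => path_weight (wt t) p).
Proof. by apply: measurable_sum => e; exact: measurable_funPT. Qed.

Lemma measurable_max_weight_ge (x : R) : 0 < x ->
  measurable [set t | x <= max_weight r (loc t) (wt t) theta q w].
Proof.
move=> x0; pose heavy_path p :=
  [set t | lqw_path r (loc t) (wt t) theta q w p &&
    (x <= path_weight (wt t) p)].
have -> : [set t | x <= max_weight r (loc t) (wt t) theta q w] =
    \bigcup_(p in [set: (#|vertex n|).-bseq (vertex n)]) heavy_path p.
  apply/seteqP; split=> t /=; last first.
    move=> [b _ /andP[bp xb]].
    have [p _ [-> pmax]] := max_weightP (ex_intro _ (val b) bp).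
    exact: le_trans (pmax _ bp).
  have [ex|noex] := pselect (exists p, lqw_path r (loc t) (wt t) theta q w p).
    have [p pp [-> _]] := max_weightP ex => xp.
    by exists (Bseq (size_lqw_path pp)) => //; rewrite /heavy_path/= pp.
  rewrite max_weight0; first by rewrite leNgt x0.
  by move=> p; apply/negP => pp; apply: noex; exists p.
apply: fin_bigcup_measurable => // b _.
have : measurable_fun setT (fun t => lqw_path r (loc t) (wt t) theta q w b &&
    (x <= path_weight (wt t) b)).
  apply: measurable_and; first exact: measurable_lqw_path.
  apply: measurable_realfun.measurable_fun_ler; first exact: measurable_cst.
  exact: measurable_path_weight.
by move=> /(_ measurableT [set true] Logic.I); rewrite setTI.
Qed.

End MeasurableMaxWeight.

(** * Growth rates *)

Section Asymptotics.
Context {R : realType}.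

Lemma cvgry_powR (T : Type) (F : set_system T) {FF : Filter F} (u : T -> R)
    (b : R) :
  0 < b -> u x @[x --> F] --> +oo -> u x `^ b @[x --> F] --> +oo.
Proof.
move=> b0 /cvgryPge u_oo; apply/cvgryPge => C; near=> x.
apply: (@le_trans _ _ (Num.max C 0)); first by rewrite le_max lexx.
have C0 : 0 <= Num.max C 0 by rewrite le_max lexx orbT.
have -> : Num.max C 0 = (Num.max C 0 `^ b^-1) `^ b.
  by rewrite -powRrM mulVf ?gt_eqF// powRr1.
have u_ge : Num.max C 0 `^ b^-1 <= u x by near: x; exact: u_oo.
apply: ge0_ler_powR; rewrite ?nnegrE ?powR_ge0 ?(ltW b0)//.
exact: le_trans (powR_ge0 _ _) u_ge.
Unshelve. all: by end_near. Qed.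

Lemma cvgry_ln (T : Type) (F : set_system T) {FF : Filter F} (u : T -> R) :
  u x @[x --> F] --> +oo -> ln (u x) @[x --> F] --> +oo.
Proof.
move=> /cvgryPge u_oo; apply/cvgryPge => C; near=> x.
have u_ge : expR C <= u x by near: x; exact: u_oo.
by rewrite -[leLHS]expRK ler_ln ?posrE ?expR_gt0// (lt_le_trans (expR_gt0 C)).
Unshelve. all: by end_near. Qed.

Lemma near_ln_le_powR (b C : R) : 0 < b ->
  \forall n \near \oo, C * ln n%:R <= n%:R `^ b.
Proof.
move=> b0; have b20 : 0 < b / 2 by rewrite divr_gt0.
near=> n; have n1 : 1 <= n%:R :> R by near: n; exact: cvgry_ge cvgr_idn 1.
have Cy : C / (b / 2) <= n%:R `^ (b / 2).
  by near: n; exact: cvgry_ge (cvgry_powR b20 cvgr_idn) _.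
set y := n%:R `^ (b / 2) in Cy.
have y0 : 0 < y by rewrite powR_gt0// (lt_le_trans ltr01).
have lny0 : 0 <= ln y by rewrite ln_powR mulr_ge0 ?(ltW b20) ?ln_ge0.
have -> : C * ln n%:R = C / (b / 2) * ln y.
  by rewrite ln_powR mulrA divfK// gt_eqF.
have -> : n%:R `^ b = y * y :> R.
  rewrite /y -powRD; first by congr (_ `^ _); lra.
  by apply/implyP => _; rewrite gt_eqF// (lt_le_trans ltr01).
apply: (@le_trans _ _ (y * ln y)); first by rewrite ler_wpM2r.
by rewrite ler_wpM2l ?(ltW y0)// ltW// ln_sublinear.
Unshelve. all: by end_near. Qed.

Lemma truncn_ge_half (x : R) : 1 <= x -> x / 2 <= (Num.truncn x)%:R.
Proof.
move=> x1; have : (1 <= Num.truncn x)%N.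
  by rewrite truncn_ge_nat// (le_trans ler01).
by rewrite -(ler_nat R); have := truncnS_gt x; rewrite -natr1; lra.
Qed.

(* By the binomial theorem the left-hand side is at most
   [y ^ k (x + y^-1) ^ J], with [k = J %/ B].  For [y = 2 / (1 - x)] the second
   base is [(1 + x) / 2 < 1], and [B] is chosen so large that [y ^ k] is at most
   [((1 + x) / 2) ^ (- J / 2)]. *)
Lemma binomial_tail_decay (x : R) : 0 <= x < 1 ->
  exists (B : nat) (c : R), [/\ (0 < B)%N, 0 < c & forall J,
    'C(J, J %/ B)%:R * x ^+ (J - J %/ B) <= expR (- (c * J%:R))].
Proof.
move=> /andP[x0 x1]; pose y := 2 / (1 - x).
have y1 : 1 <= y by rewrite /y ler_pdivlMr; lra.
have y0 : 0 < y by lra.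
have xy : x + y^-1 = (1 + x) / 2 by rewrite /y invf_div; lra.
pose a := - ln ((1 + x) / 2); have a0 : 0 < a by rewrite oppr_gt0 ln_lt0//; lra.
pose B := (Num.truncn (2 * ln y / a)).+1.
have BE : 2 * ln y <= a * B%:R.
  by rewrite [leRHS]mulrC -ler_pdivrMr//; exact/ltW/truncnS_gt.
exists B, (a / 2); split; [by []|exact: divr_gt0|move=> J].
set k := (J %/ B)%N; have kJ : (k <= J)%N by exact: leq_div.
have binomial : 'C(J, k)%:R * x ^+ (J - k) <= y ^+ k * (x + y^-1) ^+ J.
  have kJ1 : (k < J.+1)%N by rewrite ltnS.
  have yk : y ^+ k != 0 by rewrite expf_neq0// gt_eqF.
  rewrite exprDn (bigD1 (Ordinal kJ1))//= mulrDr exprVn.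
  rewrite mulrnAr mulrCA divff// mulr1 [leLHS]mulr_natl lerDl.
  rewrite mulr_ge0 ?exprn_ge0 ?(ltW y0)// sumr_ge0// => i _.
  by rewrite mulrn_wge0// mulr_ge0// exprn_ge0// invr_ge0 ltW.
apply: le_trans binomial _; have xy0 : 0 < x + y^-1 by rewrite xy; lra.
rewrite -[y in y ^+ k]lnK// -[x + y^-1]lnK// -!expRM_natl -expRD ler_expR xy.
rewrite -[ln (_ / 2)]opprK -/a.
have kB : k%:R * B%:R <= J%:R :> R by rewrite -natrM ler_nat leq_divM.
have := ler_wpM2l (ler0n R k) BE; have := ler_wpM2l (ltW a0) kB; lra.
Qed.

End Asymptotics.

Section GrowthRates.
Context {R : realType}.
Variables (K : nat) (N eps c0 : R).

Definition growth : nat := (Num.truncn (N `^ ((1 - eps / 2) / K%:R))).+1.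
Definition occupancy : nat := Num.truncn (c0 * N / 4).

Let Q := N `^ (eps / 2).
Let u := N `^ (1 - eps / 2).
Let p := (N `^ (1 - eps))^-1.

Hypotheses (N_ge1 : 1 <= N) (eps_gt0 : 0 < eps) (eps_lt : eps < 2^-1)
  (K_ge : 2 / eps <= K%:R) (c0_gt0 : 0 < c0).
Hypotheses (Q_ge : 2 ^+ K * (16 / c0) <= Q) (c0N_ge4 : 4 <= c0 * N).

Let N_gt0 : 0 < N. Proof. by rewrite (lt_le_trans ltr01). Qed.
Let K_gt0 : 0 < K%:R :> R.
Proof. by rewrite (lt_le_trans _ K_ge)// divr_gt0. Qed.
Let u_gt0 : 0 < u. Proof. exact: powR_gt0. Qed.
Let Q_ge1 : 1 <= Q.
Proof. by rewrite -[leLHS](powRr0 N) ler_powR// divr_ge0// ltW. Qed.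

Let powRD_N a b : N `^ a * N `^ b = N `^ (a + b).
Proof. by rewrite powRD//; apply/implyP => _; rewrite gt_eqF. Qed.

Let N_split : N = u * Q.
Proof. by rewrite powRD_N subrK powRr1// ltW. Qed.

Let p_u : p * u = Q.
Proof. by rewrite /p -powRN powRD_N; congr (_ `^ _); lra. Qed.

Lemma growth_expn_bounds : u <= growth%:R ^+ K <= 2 ^+ K * u.
Proof.
set e := (1 - eps / 2) / K%:R; have e0 : 0 <= e.
  by rewrite divr_ge0 ?(ltW K_gt0)//; have := eps_lt; lra.
have E1 : 1 <= N `^ e by rewrite -[leLHS](powRr0 N) ler_powR.
have -> : u = (N `^ e) ^+ K.
  by rewrite -powR_mulrn ?powR_ge0// -powRrM /e divfK// gt_eqF.
have /andP[g1 g2] := truncn_itv (le_trans ler01 E1).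
rewrite -exprMn !lerXn2r ?nnegrE ?mulr_ge0 ?powR_ge0 ?(ltW g2)//.
by rewrite /growth -natr1 -/e; lra.
Qed.

Lemma growth_le : 1 + growth%:R <= 3 * Q :> R.
Proof.
set e := (1 - eps / 2) / K%:R.
have eQ : N `^ e <= Q.
  apply: ler_powR => //; rewrite /e ler_pdivrMr//.
  by have := K_ge; rewrite ler_pdivrMr//; have := eps_gt0; lra.
have /andP[g1 _] := truncn_itv (powR_ge0 N e).
by rewrite /growth -natr1 -/e; have := Q_ge1; lra.
Qed.

Lemma occupancy_ge : c0 * N / 8 <= occupancy%:R :> R.
Proof. by apply: le_trans (truncn_ge_half _); have := c0N_ge4; lra. Qed.

Lemma growth_expn_le_half : 2 * growth%:R ^+ K <= occupancy%:R :> R.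
Proof.
have /andP[_ gu] := growth_expn_bounds; apply: le_trans occupancy_ge.
have : 2 ^+ K * 16 * u <= c0 * N.
  rewrite N_split mulrCA mulrC ler_wpM2l ?(ltW u_gt0)// [leRHS]mulrC.
  by rewrite -ler_pdivrMr// -mulrA; exact: Q_ge.
by move: gu; lra.
Qed.

Lemma growth_expn_le : (growth ^ K <= occupancy)%N.
Proof.
rewrite -(ler_nat R) natrX; have := growth_expn_le_half.
by have : 0 <= growth%:R ^+ K :> R by [exact: exprn_ge0]; lra.
Qed.

Lemma growth_expand_rate (G entropy s : R) :
  0 <= entropy -> entropy <= 2 * s -> 0 <= G ->
  (6 + G) * (16 / c0) * s <= Q ->
  (1 + growth%:R) * entropy + G * s <= p * (occupancy%:R - growth%:R ^+ K).
Proof.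
move=> entropy0 entropy_le G0 sQ; have s0 : 0 <= s by lra.
have Q0 : 0 <= Q by have := Q_ge1; lra.
have p0 : 0 <= p by rewrite invr_ge0 powR_ge0.
have left_le : (1 + growth%:R) * entropy <= 3 * Q * (2 * s).
  by apply: ler_pM => //; exact: growth_le.
have Gs : G * s <= G * s * Q by rewrite ler_peMr ?mulr_ge0.
have right_ge : c0 / 16 * (Q * Q) <= p * (occupancy%:R - growth%:R ^+ K).
  have -> : Q * Q = p * N by rewrite N_split mulrA p_u.
  rewrite mulrCA ler_wpM2l//; have := growth_expn_le_half.
  by have := occupancy_ge; lra.
have middle : (6 + G) * s * Q <= c0 / 16 * (Q * Q).
  rewrite mulrA ler_wpM2r//.
  have := ler_wpM2l (ltW (divr_gt0 c0_gt0 (ltr0n R 16))) sQ.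
  by congr (_ <= _); field; rewrite gt_eqF.
lra.
Qed.

Lemma growth_join_rate (G entropy s : R) : entropy <= 2 * s ->
  (6 + G) * s <= Q -> 0 <= s -> 2 * entropy + G * s <= p * growth%:R ^+ K.
Proof.
move=> entropy_le sQ s0; have /andP[ug _] := growth_expn_bounds.
apply: (@le_trans _ _ (p * u)); first by rewrite p_u; lra.
by rewrite ler_wpM2l// invr_ge0 powR_ge0.
Qed.

End GrowthRates.

Section Stages.
Context {R : realType}.

Definition num_stages (L : R) : nat := (Num.truncn L).+1.

Definition last_layer (K : nat) (L : R) : nat := stage_end K (num_stages L).

Definition cell_side (K : nat) (L zeta : R) : R := zeta / (last_layer K L)%:R.

Definition log_power (kappa : R) (n : nat) : R := (ln n%:R) `^ (1 + kappa).

Definition bridge_rank (kappa : R) (n : nat) (N L : R) : R :=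
  if L <= log_power kappa n then N ^+ 2 / log_power kappa n else N ^+ 2.

Definition light_bridges (B : nat) (kappa : R) (n : nat) (L : R) : nat :=
  if L <= log_power kappa n then Num.truncn L else (num_stages L %/ B)%N.

Lemma alpha_scaleE (H : R -> R) kappa n N L :
  alpha_scale H kappa n N L = H (bridge_rank kappa n N L).
Proof. by rewrite /alpha_scale /bridge_rank /log_power; case: ifP. Qed.

Lemma num_stages_bounds L : 0 <= L -> L < (num_stages L)%:R <= L + 1.
Proof.
by move=> /truncn_itv/andP[L1 L2]; rewrite L2/= /num_stages -natr1 lerD2r.
Qed.

Lemma light_bridges_le B kappa n L :
  (light_bridges B kappa n L <= num_stages L)%N.
Proof.
by rewrite /light_bridges; case: ifP => _; [exact: leqnSn|exact: leq_div].
Qed.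

Lemma light_bridges_ge B kappa n L : (0 < B)%N -> 0 <= L ->
  B%:R^-1 * L <= (light_bridges B kappa n L).+1%:R.
Proof.
move=> B0 L0; have /andP[LJ _] := num_stages_bounds L0.
rewrite mulrC ler_pdivrMr ?ltr0n//; apply: le_trans (ltW LJ) _.
rewrite -natrM ler_nat /light_bridges; case: ifP => _; first exact: leq_pmulr.
by rewrite ltnW// ltn_ceil.
Qed.

Variables (K : nat) (r zeta : R).
Let L := zeta / r.
Hypotheses (K_gt0 : (0 < K)%N) (r_gt0 : 0 < r) (zeta_gt0 : 0 < zeta).
Hypothesis L_ge1 : 1 <= L.
Let l := last_layer K L.
Let A : R := K.*2.+2%:R.

Let A_ge4 : 4 <= A.
Proof. by rewrite /A (ler_nat R 4) !ltnS (leq_double 1). Qed.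

Lemma last_layer_bounds : 2 * L < l%:R <= 3 * A * L.
Proof.
have /andP[J1 J2] := num_stages_bounds (le_trans ler01 L_ge1).
have lE : l%:R = ((num_stages L)%:R + 1) * A - 1.
  have h : ((num_stages L).+1 * K.*2.+2)%N = l.+1 by rewrite mulSn addnC addnS.
  by rewrite natr1 /A -natrM h -natr1 addrK.
have lower : 4 * (L + 1) <= ((num_stages L)%:R + 1) * A.
  rewrite mulrC; apply: ler_pM => //.
    by rewrite addr_ge0// (le_trans ler01).
  by rewrite lerD2r ltW.
have upper : ((num_stages L)%:R + 1) * A <= 3 * L * A.
  by rewrite ler_wpM2r//; have := L_ge1; lra.
by rewrite lE; have L1 := L_ge1; apply/andP; split; lra.
Qed.

Let l_gt0 : 0 < l%:R :> R.
Proof.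
have /andP[+ _] := last_layer_bounds; apply: lt_trans.
by rewrite mulr_gt0// (lt_le_trans ltr01).
Qed.

Let zetaE : zeta = L * r. Proof. by rewrite divfK// gt_eqF. Qed.

Lemma cell_side_gt0 : 0 < cell_side K L zeta.
Proof. exact: divr_gt0 zeta_gt0 l_gt0. Qed.

Lemma cell_sideE : zeta = l%:R * cell_side K L zeta.
Proof. by rewrite mulrC /cell_side divfK// gt_eqF// l_gt0. Qed.

Lemma cell_side_lt : 2 * cell_side K L zeta < r.
Proof.
have /andP[Ll _] := last_layer_bounds.
by rewrite mulrA ltr_pdivrMr// zetaE mulrA mulrC ltr_pM2l.
Qed.

Lemma cell_side_ge : r / (3 * A) <= cell_side K L zeta.
Proof.
have /andP[_ lL] := last_layer_bounds.
have A0 : 0 < 3 * A by rewrite mulr_gt0.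
rewrite ler_pdivlMr// mulrAC ler_pdivrMr// zetaE [leRHS]mulrAC.
by rewrite [leRHS]mulrC ler_wpM2l ?(ltW r_gt0)// mulrC.
Qed.

End Stages.

(* The sides of a cell have length [rho / 2 >= r / (6 (2 K + 2))]. *)
Definition mass_constant (R : realType) (eps1 : R) (K : nat) : R :=
  eps1 / (36 * K.*2.+2%:R ^+ 2).

(** * The estimate for a fixed number of vertices *)

Section Model.
Context {d : measure_display} {T : measurableType d} {R : realType}.
Variables (P : probability T R) (n : nat).
Variables (X : 'I_n -> {RV P >-> (R * R)%type}).
Variables (W : {set vertex n} -> {RV P >-> R}) (nu : probability R R).
Hypothesis X_indep : mutually_independent P [set: 'I_n]%SET
  (fun i => g_sigma_algebra_preimage (X i)).
Hypothesis W_law : forall e, e \in K2_edges n ->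
  forall A : set R, measurable A -> distribution P (W e) A = nu A.
Hypothesis W_indep : mutually_independent P (K2_edges n)
  (fun e => g_sigma_algebra_preimage (W e)).
Hypothesis XW_indep : independent_classes P
  (sigma_of_family [set: 'I_n]%SET (fun i => X i : T -> R * R))
  (sigma_of_family (K2_edges n) (fun e => W e : T -> R)).

Definition heavy_edges (w : R) : T -> {set {set vertex n}} :=
  selected (K2_edges n) W `[w, +oo[%classic.

Lemma heavy_edgesE w e t :
  (e \in heavy_edges w t) = (e \in K2_edges n) && (w <= W e t).
Proof. by rewrite in_selected mem_setE in_itv/= andbT. Qed.

Lemma measurable_heavy_edges w : measurable_fun setT (heavy_edges w).
Proof. by apply: measurable_selected; exact: measurable_itv. Qed.

Lemma heavy_edges_hitting_rate (w p : R) : (p%:E <= nu `[w, +oo[%classic)%E ->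
  hitting_rate (law (measurable_heavy_edges w) P) (K2_edges n) p.
Proof.
have mI : measurable `[w, +oo[%classic by exact: measurable_itv.
move=> pw; apply: (selected_hitting_rate mI W_indep) => e eK.
rewrite -lee_fin -prE; last exact: measurable_funPTI.
by apply: le_trans pw _; rewrite -(W_law eK mI).
Qed.

Section Bound.
Variables (K J : nat) (rho zeta : R).
Let l := stage_end K J.

Definition random_pattern (t : T) : {set vertex n * 'I_l.+1} :=
  cell_pattern l rho (location zeta (fun i => X i t)).

Lemma sigma_random_pattern (Q : set {set vertex n * 'I_l.+1}) :
  sigma_of_family [set: 'I_n]%SET (fun i => X i : T -> R * R)
    (random_pattern @^-1` Q).
Proof.
apply: sigma_of_family_finset => -[[i|o] k].
  rewrite (_ : mkset _ = X i @^-1` cell rho k).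
    by apply: sigma_preimage; rewrite ?finset.in_setT//; exact: measurable_cell.
  by apply/seteqP; split=> t /=; rewrite in_cell_pattern in_setE.
pose added : R * R := if o then (zeta, 0) else (0, 0).
have [ok|/negbTE ok] := boolP (added \in cell rho k).
  rewrite (_ : mkset _ = setT).
    exact: (@measurableT _ (g_sigma_algebraType _)).
  by apply/seteqP; split=> t //= _; rewrite in_cell_pattern.
rewrite (_ : mkset _ = set0); first exact: sigma_algebra0.
by apply/seteqP; split=> t //=; rewrite in_cell_pattern -/added ok.
Qed.

Lemma measurable_random_pattern : measurable_fun setT random_pattern.
Proof.
move=> _ Q _; rewrite setTI.
exact: sigma_of_family_measurable (sigma_random_pattern Q).
Qed.

Variables (M : nat) (a : R).
Hypotheses (rho_gt0 : 0 < rho) (zetaE : zeta = l%:R * rho).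
Hypothesis X_mass : forall i k, (0 < k < l)%N ->
  a <= pr P (X i @^-1` cell rho k).

Lemma layered_failure_le : pr P [set t | ~ layered M (random_pattern t)] <=
  l%:R * (2 ^+ M * expR (- (n%:R * a / 2))).
Proof.
pose occupants k := selected [set: 'I_n]%SET X (cell rho k).
pose C (k : 'I_l) := (0 < k)%N.
apply: (@le_trans _ _ (#|C|%:R * (2 ^+ M * expR (- (n%:R * a / 2)))));
    last first.
  rewrite ler_wpM2r ?mulr_ge0 ?exprn_ge0 ?expR_ge0//.
  by rewrite ler_nat -[leqRHS](card_ord l) max_card.
apply: (@union_bound_const _ T R P _ C
    (fun k => occupants k @^-1` [set A : {set 'I_n} | (#|A| <= M)%N])).
- exact: (measurable_preimage_finset measurable_random_pattern
    (fun Z => ~ layered M Z)).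
- move=> k _; apply: measurable_preimage_finset; apply: measurable_selected.
  exact: measurable_cell.
- move=> t /= nZ; apply: contrapT => noF; apply: nZ.
  apply: cell_pattern_layered => // k kl.
  rewrite leqNgt; apply/negP => kM; apply: noF.
  have /andP[k0 kl'] := kl; exists (Ordinal kl') => //=.
  apply: leq_trans (ltnW kM); apply: subset_leq_card.
  by apply/fintype.subsetP => i; rewrite !inE.
move=> k k0; have mc := measurable_cell rho k.
have := product_law_lower_tail (y := 2) (a := a) M
  (selected_product_law mc X_indep erefl).
rewrite card_ord (_ : 1 - 2^-1 = 2^-1); last by lra.
apply => [i|i|]; [|by apply: X_mass; rewrite ltn_ord andbT|by rewrite ler1n].
by rewrite pr_ge0 -(pr_setT P) le_pr//; exact: measurable_funPTI.
Qed.

Variables (g k : nat) (w alpha p p' lambda : R).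
Hypotheses (K_gt0 : (0 < K)%N) (g_gt0 : (0 < g)%N) (gM : (g ^ K <= M)%N).
Hypothesis kJ : (k <= J)%N.
Hypotheses (p_ge0 : 0 <= p) (p'_ge0 : 0 <= p') (lambda_ge0 : 0 <= lambda).
Hypotheses (w_tail : (p%:E <= nu `[w, +oo[%classic)%E)
  (alpha_tail : (p'%:E <= nu `[alpha, +oo[%classic)%E).
Hypothesis expand_rate :
  (1 + g%:R) * ln #|vertex n|.+1%:R + lambda <= p * (M%:R - g%:R ^+ K).
Hypothesis join_rate : 2 * ln #|vertex n|.+1%:R + lambda <= p * g%:R ^+ K.

Definition bad_weights (Z : {set vertex n * 'I_l.+1}) : set T :=
  heavy_edges w @^-1` [set E | ~ expander E (layer Z) g K l] `|`
  heavy_edges alpha @^-1` [set E : {set {set vertex n}} |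
    (#|[set j : 'I_J | ~~ [disjoint bridge K Z j & E]]%SET| <= k)%N].

Lemma sigma_bad_weights Z :
  sigma_of_family (K2_edges n) (fun e => W e : T -> R) (bad_weights Z).
Proof.
by apply: (@measurableU _ (g_sigma_algebraType _)); apply: sigma_selected;
   exact: measurable_itv.
Qed.

Lemma pr_bad_weights_le Z : layered M Z ->
  pr P (bad_weights Z) <= (l * K.*2.+1)%:R * expR (- lambda) +
    'C(J, k)%:R * expR (- (p' * (M * M)%:R)) ^+ (J - k).
Proof.
move=> ZM; have l_gt1 := stage_end_gt1 J K_gt0.
have mheavy x Q : measurable (heavy_edges x @^-1` Q).
  exact: measurable_preimage_finset (measurable_heavy_edges x) Q.
apply: le_trans (pr_setU_le P (mheavy _ _) (mheavy _ _)) _; apply: lerD.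
  apply: (expander_failure_le p_ge0 (heavy_edges_hitting_rate w_tail) g_gt0 gM
    lambda_ge0 expand_rate join_rate) => j jl.
  - exact: (layer_disjoint ZM).
  - exact: (layer_cross_edges ZM l_gt1).
  - exact: (layered_card ZM).
have stage_endl (j : 'I_J) := stage_end_lt K_gt0 (ltn_ord j).
have := few_hits_le (C := fun j : 'I_J => bridge K Z j) (m := (M * M)%N)
  (k := k) p'_ge0 (heavy_edges_hitting_rate alpha_tail).
rewrite card_ord; apply=> [j|j|i j ij|//].
- exact: (layer_cross_edges ZM l_gt1 (ltnW (stage_endl j))).
- rewrite card_cross; last exact: (layer_disjoint ZM (ltnW (stage_endl j))).
  apply: leq_mul; apply: (layered_card ZM); last exact: stage_endl.
  by rewrite (ltnW (stage_endl j)) andbT /stage_end addnS.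
- apply: (layer_cross_disjoint ZM (ltnW (stage_endl i)) (ltnW (stage_endl j))).
  by rewrite eqn_add2r eqn_mul2r/=.
Qed.

Variables (r q theta x : R).
Hypotheses (rho_r : 2 * rho < r) (q_rho : q <= rho / 2).
Hypothesis l_theta : l%:R <= theta.
Hypotheses (w_ge0 : 0 <= w) (w_alpha : w <= alpha).
Hypotheses (x_gt0 : 0 < x) (x_le : x <= k.+1%:R * alpha).

Lemma pr_max_weight_ge :
  ((1 - (l%:R * (2 ^+ M * expR (- (n%:R * a / 2))) +
     ((l * K.*2.+1)%:R * expR (- lambda) +
      'C(J, k)%:R * expR (- (p' * (M * M)%:R)) ^+ (J - k))))%:E <=
  P [set t | (x <= max_weight r (location zeta (fun i => X i t))
    (fun e => W e t) theta q w)%R])%E.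
Proof.
set E := [set t | x <= _]; set b := (_ + _ * _ ^+ _).
have mE : measurable E by exact: measurable_max_weight_ge.
have mbad Z : measurable (bad_weights Z).
  exact: sigma_of_family_measurable (sigma_bad_weights Z).
have b_ge0 : 0 <= b by rewrite addr_ge0// mulr_ge0// ?exprn_ge0// expR_ge0.
pose F := joint_event random_pattern bad_weights (layered M).
have F_le : pr P F <= b.
  apply: (pr_joint_event_le measurable_random_pattern mbad _ b_ge0) => Z.
    by apply: XW_indep; [exact: sigma_random_pattern|exact: sigma_bad_weights].
  exact: pr_bad_weights_le.
have mF : measurable F.
  exact: (measurable_joint_event _ measurable_random_pattern mbad).
suff failure : pr P (~` E) <= l%:R * (2 ^+ M * expR (- (n%:R * a / 2))) + b.
  by rewrite (prE P mE) lee_fin lerBlDr -lerBlDl -pr_setC.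
have mL : measurable [set t | ~ layered M (random_pattern t)].
  exact: (measurable_preimage_finset measurable_random_pattern
    (fun Z => ~ layered M Z)).
apply: le_trans (lerD layered_failure_le F_le).
apply: le_trans (pr_setU_le P mL mF).
apply: le_pr; [exact: measurableC|exact: measurableU|] => t /= notE.
have [ZM|] := pselect (layered M (random_pattern t)); last by left.
right; split=> //; apply: contrapT => /not_orP[/= /contrapT exp /negP].
rewrite -ltnNge => many; apply: notE; rewrite /E/=; apply: le_trans x_le _.
apply: (max_weight_ge_bridges K_gt0 gM ZM exp _ rho_gt0 rho_r q_rho l_theta
  w_ge0 (le_trans w_ge0 w_alpha) _ _ erefl many).
- apply/fintype.subsetP => e; rewrite !heavy_edgesE => /andP[-> /=].
  exact: le_trans.
- by move=> e; rewrite heavy_edgesE => /andP[].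
- by move=> e; rewrite heavy_edgesE => /andP[].
Qed.

End Bound.

Section FixedSize.
Variables (f : R * R -> R) (eps1 : R).
Hypotheses (eps1_gt0 : 0 < eps1) (f_meas : measurable_fun unit_square f)
  (f_ge : forall x, unit_square x -> eps1 <= f x).
Hypothesis X_law : forall (i : 'I_n) (A : set (R * R)), measurable A ->
  (distribution P (X i) A
   = \int[lebesgue_measure \x lebesgue_measure]_(x in A `&` unit_square)
       (f x)%:E)%E.

Variables (K B : nat) (r zeta q eps gamma kappa z0 : R).
Let A : R := K.*2.+2%:R.
Let c0 := mass_constant eps1 K.
Let L := zeta / r.
Let N := n%:R * r ^+ 2.
Let H := inv_ccdf nu.
Let J := num_stages L.
Let l := last_layer K L.
Let rho := cell_side K L zeta.
Let g := growth K N eps.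
Let M := occupancy N c0.
Let p := (N `^ (1 - eps))^-1.
Let z := bridge_rank kappa n N L.
Let k := light_bridges B kappa n L.
Let lambda := (gamma + 3) * ln n%:R.

Hypotheses (K_gt0 : (0 < K)%N) (B_gt0 : (0 < B)%N) (gamma_gt0 : 0 < gamma).
Hypothesis H_incr : forall z1 z2, z0 <= z1 -> z1 < z2 -> H z1 < H z2.
Hypotheses (r_gt0 : 0 < r) (zeta_range : 0 < zeta < 2^-1) (L_ge1 : 1 <= L).
Hypothesis q_le : q <= r / (6 * A).
Hypothesis rank_bounds : z0 < N `^ (1 - eps) < z.
Hypothesis growth_rates :
  [/\ (g ^ K <= M)%N,
      (1 + g%:R) * ln #|vertex n|.+1%:R + lambda <= p * (M%:R - g%:R ^+ K) &
      2 * ln #|vertex n|.+1%:R + lambda <= p * g%:R ^+ K].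
Hypothesis occupancy_tail :
  2 ^+ M * expR (- (n%:R * (c0 * r ^+ 2) / 2)) <= expR (- lambda).
Hypothesis bridge_tail :
  'C(J, k)%:R * expR (- (z^-1 * (M * M)%:R)) ^+ (J - k) <=
    J%:R * expR (- lambda).
Hypothesis total_failure :
  (l * K.*2.+3)%:R * expR (- lambda) <= (n%:R `^ (1 + gamma))^-1.

Let H_gt0 y : z0 < y -> 0 < H y.
Proof.
by move=> z0y; apply: le_lt_trans (inv_ccdf_ge0 nu z0) (H_incr _ z0y).
Qed.

Let rho_gt0 : 0 < rho.
Proof. by have /andP[zeta_gt0 _] := zeta_range; exact: cell_side_gt0. Qed.

Let zetaE : zeta = l%:R * rho.
Proof. exact: cell_sideE. Qed.

Let rho_ge : r / (3 * A) <= rho.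
Proof. exact: cell_side_ge. Qed.

Lemma cell_probability_ge i j : (0 < j < l)%N ->
  c0 * r ^+ 2 <= pr P (X i @^-1` cell rho j).
Proof.
move=> /andP[_ jl]; have /andP[_ zeta_lt] := zeta_range.
have jz : j.+1%:R * rho <= zeta by rewrite zetaE ler_wpM2r ?ler_nat// ltW.
have rz : rho <= zeta by apply: le_trans jz; rewrite ler_peMl ?ler1n// ltW.
have cS : cell rho j `<=` unit_square.
  by apply: cell_unit_square => //; apply: le_trans (ltW zeta_lt).
have mc := measurable_cell rho j.
rewrite -lee_fin -prE; last exact: measurable_funPTI.
rewrite -[leRHS]/(distribution P (X i) (cell rho j)) X_law//.
apply: le_trans (cell_mass_ge rho_gt0 (ltW eps1_gt0) f_meas f_ge cS).
have -> : c0 * r ^+ 2 = eps1 * (r / (3 * A) / 2) ^+ 2.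
  by rewrite /c0 /mass_constant -/A; field; rewrite gt_eqF.
have half0 : 0 <= r / (3 * A) / 2 by rewrite !divr_ge0 ?mulr_ge0 ?ltW.
have half_le : r / (3 * A) / 2 <= rho / 2.
  by rewrite ler_wpM2r ?rho_ge// invr_ge0.
rewrite lee_fin ler_wpM2l ?(ltW eps1_gt0)//.
by rewrite lerXn2r// nnegrE (le_trans half0).
Qed.

Let lambda_ge0 : 0 <= lambda.
Proof.
rewrite mulr_ge0//; first by have := gamma_gt0; lra.
by case: n => [|m]; [rewrite ln0|rewrite ln_ge0// ler1n].
Qed.

Let q_rho : q <= rho / 2.
Proof.
apply: le_trans q_le _; rewrite ler_pdivlMr//; apply: le_trans rho_ge.
by rewrite le_eqVlt; apply/orP; left; apply/eqP; field; rewrite gt_eqF.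
Qed.

Lemma total_bound_le :
  l%:R * (2 ^+ M * expR (- (n%:R * (c0 * r ^+ 2) / 2))) +
  ((l * K.*2.+1)%:R * expR (- lambda) +
   'C(J, k)%:R * expR (- (z^-1 * (M * M)%:R)) ^+ (J - k)) <=
  (n%:R `^ (1 + gamma))^-1.
Proof.
have : (J <= last_layer K L)%N.
  by rewrite /last_layer /stage_end (leq_trans _ (leq_addr _ _))// leq_pmulr.
move: total_failure; rewrite /l; move: (last_layer K L) => m + Jm.
apply: le_trans; rewrite (mulnS m K.*2.+2) (mulnSr m K.*2.+1) 2!natrD 2!mulrDl.
apply: lerD; first by rewrite ler_wpM2l.
apply: lerD => //; apply: le_trans bridge_tail _.
by rewrite ler_wpM2r ?expR_ge0// ler_nat.
Qed.

Lemma pr_max_weight_ge_scale :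
  ((1 - (n%:R `^ (1 + gamma))^-1)%:E <=
   P [set t | (B%:R^-1 * L * alpha_scale H kappa n N L <=
     max_weight r (location zeta (fun i => X i t)) (fun e => W e t)
       (3 * A * L) q (H (N `^ (1 - eps))))%R])%E.
Proof.
have /andP[z0w wz] := rank_bounds; have [gM expand join] := growth_rates.
have L_gt0 : 0 < L by exact: lt_le_trans L_ge1.
have Hw := H_gt0 z0w; have Hz := H_gt0 (lt_trans z0w wz).
have rank_inv_ge0 y : N `^ (1 - eps) <= y -> 0 <= y^-1.
  by move=> Ny; rewrite invr_ge0 (le_trans (powR_ge0 _ _) Ny).
have /andP[_ l_theta] := last_layer_bounds K_gt0 L_ge1.
rewrite alpha_scaleE -/z.
apply: le_trans (pr_max_weight_ge rho_gt0 zetaE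
  cell_probability_ge K_gt0 (isT : 0 < g)%N gM (light_bridges_le B kappa n L)
  (rank_inv_ge0 _ (lexx _)) (rank_inv_ge0 _ (ltW wz)) lambda_ge0
  (inv_ccdf_tail Hw) (inv_ccdf_tail Hz) expand join
  (cell_side_lt K_gt0 r_gt0 L_ge1) q_rho l_theta (ltW Hw)
  (ltW (H_incr (ltW z0w) wz)) _ _).
- by rewrite lee_fin lerD2l lerN2; exact: total_bound_le.
- by apply: mulr_gt0 Hz; apply: mulr_gt0 L_gt0; rewrite invr_gt0 ltr0n.
- by rewrite ler_wpM2r ?(ltW Hz)// light_bridges_ge// ltW.
Qed.

End FixedSize.

End Model.

(** * The asymptotic regime *)

Section Regime.
Context {R : realType}.
Variables (r zeta : nat -> R) (beta : R).
Hypotheses (r_gt0 : forall n, 0 < r n) (zeta_lt : forall n, zeta n < 2^-1).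
Hypothesis beta_lt_half : beta < 2^-1.
Hypothesis r_lower : \forall n \near \oo, (n%:R `^ beta)^-1 <= r n.
Let N n := n%:R * r n ^+ 2.
Let L n := zeta n / r n.
Let tau : R := 1 - 2 * beta.

Let tau_gt0 : 0 < tau.
Proof. by rewrite /tau; have := beta_lt_half; lra. Qed.

Lemma near_expected_degree_ge : \forall n \near \oo, n%:R `^ tau <= N n.
Proof.
near=> n; have n_gt0 : 0 < n%:R :> R by near: n; exact: cvgry_gt cvgr_idn 0.
have r_ge : (n%:R `^ beta)^-1 <= r n by near: n.
have -> : n%:R `^ tau = n%:R * ((n%:R `^ beta)^-1) ^+ 2 :> R.
  rewrite /tau powRB; last by apply/implyP => _; rewrite gt_eqF.
  rewrite powRr1 ?(ltW n_gt0)// exprVn -powR_mulrn ?powR_ge0//.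
  by rewrite -powRrM (mulrC 2).
rewrite ler_wpM2l ?(ltW n_gt0)// lerXn2r ?nnegrE ?invr_ge0 ?powR_ge0//.
exact: le_trans r_ge.
Unshelve. all: by end_near. Qed.

Lemma expected_degree_cvgry : N n @[n --> \oo] --> +oo.
Proof.
apply/cvgryPge => C; near=> n; apply: (@le_trans _ _ (n%:R `^ tau)).
  by near: n; exact: (cvgry_ge (cvgry_powR tau_gt0 cvgr_idn)).
by near: n; exact: near_expected_degree_ge.
Unshelve. all: by end_near. Qed.

Lemma near_powR_degree_ge (b C : R) : 0 < b ->
  \forall n \near \oo, C <= N n `^ b.
Proof.
by move=> b0; exact: cvgry_ge (cvgry_powR b0 expected_degree_cvgry) C.
Qed.

Lemma near_ln_le_powR_degree (b C : R) : 0 < b ->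
  \forall n \near \oo, C * ln n%:R <= N n `^ b.
Proof.
move=> b0; near=> n; apply: (@le_trans _ _ (n%:R `^ (tau * b))).
  by near: n; apply: near_ln_le_powR; exact: mulr_gt0.
have N_ge : n%:R `^ tau <= N n by near: n; exact: near_expected_degree_ge.
by rewrite powRrM ge0_ler_powR ?nnegrE ?powR_ge0 ?(ltW b0) ?(le_trans _ N_ge).
Unshelve. all: by end_near. Qed.

Lemma near_ln_le_degree (C x : R) : 0 < x ->
  \forall n \near \oo, C * ln n%:R <= x * N n.
Proof.
move=> x0; near=> n; rewrite -ler_pdivrMl// mulrA -[leRHS]powRr1.
  by near: n; exact: near_ln_le_powR_degree.
by rewrite mulr_ge0 ?sqr_ge0.
Unshelve. all: by end_near. Qed.

Lemma near_ln_le_log_power (kappa C x : R) : 0 < kappa -> 0 < x ->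
  \forall n \near \oo, C * ln n%:R <= x * log_power kappa n.
Proof.
move=> kappa0 x0; near=> n; have ln_gt0 : 0 < ln n%:R :> R.
  by near: n; exact: cvgry_gt (cvgry_ln cvgr_idn) 0.
have Cx : C / x <= (ln n%:R) `^ kappa.
  by near: n; exact: (cvgry_ge (cvgry_powR kappa0 (cvgry_ln cvgr_idn))).
rewrite /log_power powRD; last by apply/implyP => _; rewrite gt_eqF.
rewrite powRr1 ?(ltW ln_gt0)// mulrCA mulrC ler_wpM2l ?(ltW ln_gt0)//.
by rewrite -ler_pdivrMl// mulrC.
Unshelve. all: by end_near. Qed.

Lemma near_log_power_le_degree (kappa : R) : 0 < kappa ->
  \forall n \near \oo, 0 < log_power kappa n <= N n.
Proof.
move=> kappa0; have k1 : 0 < 1 + kappa by rewrite addr_gt0.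
near=> n; have ln_gt0 : 0 < ln n%:R :> R.
  by near: n; exact: cvgry_gt (cvgry_ln cvgr_idn) 0.
have N0 : 0 <= N n by rewrite mulr_ge0 ?sqr_ge0.
rewrite powR_gt0//=.
have lnN : 1 * ln n%:R <= N n `^ (1 + kappa)^-1.
  by near: n; apply: near_ln_le_powR_degree; rewrite invr_gt0.
have -> : N n = (N n `^ (1 + kappa)^-1) `^ (1 + kappa).
  by rewrite -powRrM mulVf ?gt_eqF// powRr1.
rewrite mul1r in lnN.
by rewrite /log_power ge0_ler_powR ?nnegrE ?powR_ge0 ?(ltW k1) ?(ltW ln_gt0).
Unshelve. all: by end_near. Qed.

Lemma near_rank_bounds (z0 eps kappa : R) : 0 < eps < 1 -> 0 < kappa ->
  \forall n \near \oo,
    z0 < N n `^ (1 - eps) < bridge_rank kappa n (N n) (L n).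
Proof.
move=> /andP[eps0 eps1] kappa0; near=> n; apply/andP; split.
  apply: (@lt_le_trans _ _ (z0 + 1)); first by rewrite ltrDl.
  by near: n; apply: near_powR_degree_ge; rewrite subr_gt0.
have N_gt1 : 1 < N n by near: n; exact: cvgry_gt expected_degree_cvgry 1.
have N_gt0 : 0 < N n by exact: lt_trans N_gt1.
have pow_lt : N n `^ (1 - eps) < N n.
  rewrite /powR gt_eqF// -[ltRHS]lnK ?posrE// ltr_expR.
  by rewrite gtr_pMl ?ln_gt0//; lra.
apply: lt_le_trans pow_lt _; rewrite /bridge_rank expr2.
have /andP[log0 logN] : 0 < log_power kappa n <= N n.
  by near: n; exact: near_log_power_le_degree.
case: ifP => _; last by rewrite ler_peMl// ltW.
by rewrite ler_pdivlMr// ler_wpM2l// ltW.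
Unshelve. all: by end_near. Qed.

Lemma near_ratio_le : \forall n \near \oo, L n <= n%:R.
Proof.
near=> n; have n1 : 1 <= n%:R :> R by near: n; exact: cvgry_ge cvgr_idn _.
have n0 : 0 < n%:R :> R by exact: lt_le_trans n1.
have r_ge : (n%:R `^ beta)^-1 <= r n by near: n.
rewrite ler_pdivrMr//; apply: (@le_trans _ _ 1).
  by apply: (le_trans (ltW (zeta_lt n))); rewrite invf_le1// ler1n.
have : 1 <= r n * n%:R `^ beta by rewrite -ler_pdivrMr ?powR_gt0// mul1r.
move=> /le_trans; apply; rewrite mulrC ler_wpM2r ?(ltW (r_gt0 n))//.
rewrite -[leRHS]powRr1 ?(ltW n0)// ler_powR//.
by have := beta_lt_half; lra.
Unshelve. all: by end_near. Qed.

Lemma near_min_length_le (c C : R) : beta < c -> 0 < C ->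
  \forall n \near \oo, (n%:R `^ c)^-1 <= r n / C.
Proof.
move=> beta_lt_c C0; have cb0 : 0 < c - beta by rewrite subr_gt0.
near=> n; have n0 : 0 < n%:R :> R by near: n; exact: cvgry_gt cvgr_idn 0.
have r_ge : (n%:R `^ beta)^-1 <= r n by near: n.
have C_le : C <= n%:R `^ (c - beta).
  by near: n; exact: (cvgry_ge (cvgry_powR cb0 cvgr_idn)).
rewrite -[c](subrK beta) powRD; last by apply/implyP => _; rewrite gt_eqF.
rewrite invfM [leRHS]mulrC; apply: ler_pM; rewrite ?invr_ge0 ?powR_ge0//.
by rewrite lef_pV2 ?posrE ?powR_gt0.
Unshelve. all: by end_near. Qed.

Lemma near_growth_rates (K : nat) (eps c0 G : R) : 0 < eps < 2^-1 ->
  2 / eps <= K%:R -> 0 < c0 -> 0 <= G -> \forall n \near \oo,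
    let g := growth K (N n) eps in let M := occupancy (N n) c0 in
    let p := (N n `^ (1 - eps))^-1 in
    [/\ (g ^ K <= M)%N,
        (1 + g%:R) * ln #|vertex n|.+1%:R + G * ln n%:R <=
          p * (M%:R - g%:R ^+ K) &
        2 * ln #|vertex n|.+1%:R + G * ln n%:R <= p * g%:R ^+ K].
Proof.
move=> /andP[eps0 eps_lt] K_ge c00 G0.
have eps20 : 0 < eps / 2 by rewrite divr_gt0.
near=> n => /=; have n_gt2 : (2 < n)%N by near: n; exact: nbhs_infty_gt.
have N_ge1 : 1 <= N n by near: n; exact: cvgry_ge expected_degree_cvgry 1.
have Q_ge : 2 ^+ K * (16 / c0) <= N n `^ (eps / 2).
  by near: n; exact: near_powR_degree_ge.
have c0N_ge4 : 4 <= c0 * N n.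
  rewrite mulrC -ler_pdivrMr//; near: n.
  exact: cvgry_ge expected_degree_cvgry (4 / c0).
have n_gt0 : 0 < n%:R :> R by rewrite ltr0n (ltn_trans _ n_gt2).
have lnn0 : 0 <= ln n%:R :> R by rewrite ln_ge0// ler1n (ltn_trans _ n_gt2).
have entropy_le : ln #|vertex n|.+1%:R <= 2 * ln n%:R :> R.
  rewrite mulr_natl -lnXn// ler_ln ?posrE ?exprn_gt0// -natrX ler_nat.
  by rewrite card_sum card_ord card_bool expnS expn1; nia.
split.
- exact: growth_expn_le eps0 eps_lt K_ge c00 Q_ge c0N_ge4.
- apply: growth_expand_rate => //; first by rewrite ln_ge0// ler1n.
  by near: n; exact: near_ln_le_powR_degree.
- by apply: growth_join_rate => //; near: n; exact: near_ln_le_powR_degree.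
Unshelve. all: by end_near. Qed.

Lemma near_occupancy_tail (c0 G : R) : 0 < c0 -> \forall n \near \oo,
  2 ^+ occupancy (N n) c0 * expR (- (n%:R * (c0 * r n ^+ 2) / 2)) <=
    expR (- (G * ln n%:R)).
Proof.
move=> c00; near=> n; set M := occupancy _ _.
have lnN : G * ln n%:R <= c0 / 4 * N n.
  by near: n; apply: near_ln_le_degree; rewrite divr_gt0.
have N0 : 0 <= N n by rewrite mulr_ge0 ?sqr_ge0.
have M_le : M%:R <= c0 * N n / 4.
  by have /andP[] := truncn_itv (divr_ge0 (mulr_ge0 (ltW c00) N0) (ler0n R 4)).
have -> : n%:R * (c0 * r n ^+ 2) / 2 = c0 * N n / 2 by rewrite mulrCA.
apply: (@le_trans _ _ (expR M%:R * expR (- (c0 * N n / 2)))).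
  rewrite ler_wpM2r ?expR_ge0// -[M%:R]mulr1 expRM_natl.
  by rewrite lerXn2r ?nnegrE ?expR_ge0// -[2]/(1 + 1); exact: expR_ge1Dx.
by rewrite -expRD ler_expR; lra.
Unshelve. all: by end_near. Qed.

Lemma near_total_failure (K : nat) (G : R) : (0 < K)%N ->
  (\forall n \near \oo, 1 <= L n) -> \forall n \near \oo,
  (last_layer K (L n) * K.*2.+3)%:R * expR (- ((G + 3) * ln n%:R)) <=
    (n%:R `^ (1 + G))^-1.
Proof.
move=> K0 L_lower; pose A : R := K.*2.+2%:R; near=> n.
have n0 : 0 < n%:R :> R by near: n; exact: cvgry_gt cvgr_idn 0.
have L1 : 1 <= L n by near: n.
have /andP[_ l_le] := last_layer_bounds K0 L1.
apply: (@le_trans _ _ (n%:R * n%:R * expR (- ((G + 3) * ln n%:R)))).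
  rewrite ler_wpM2r ?expR_ge0// natrM.
  apply: (@le_trans _ _ (3 * A * K.*2.+3%:R * L n)).
    by rewrite mulrAC ler_wpM2r.
  have const_le : 3 * A * K.*2.+3%:R <= n%:R.
    by near: n; exact: cvgry_ge cvgr_idn _.
  have L_le : L n <= n%:R by near: n; exact: near_ratio_le.
  by apply: ler_pM => //; [rewrite !mulr_ge0|exact: (le_trans ler01 L1)].
rewrite -{1 2}[n%:R]lnK// -!expRD /powR gt_eqF// -expRN ler_expR.
lra.
Unshelve. all: by end_near. Qed.

Lemma near_bridge_tail (B : nat) (kappa c0 c2 G : R) :
  0 < kappa -> 0 < c0 -> 0 < c2 ->
  (forall J, 'C(J, J %/ B)%:R * expR (- (c0 ^+ 2 / 64)) ^+ (J - J %/ B) <=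
     expR (- (c2 * J%:R))) ->
  (\forall n \near \oo, 1 <= L n) -> \forall n \near \oo,
  let J := num_stages (L n) in let k := light_bridges B kappa n (L n) in
  let M := occupancy (N n) c0 in
  let z := bridge_rank kappa n (N n) (L n) in
  'C(J, k)%:R * expR (- (z^-1 * (M * M)%:R)) ^+ (J - k) <=
    J%:R * expR (- (G * ln n%:R)).
Proof.
move=> kappa0 c00 c20 decay L_lower.
have x0 : 0 < c0 ^+ 2 / 64 by rewrite divr_gt0// exprn_gt0.
near=> n => /=; set J := num_stages _; set M := occupancy _ _.
have N_gt0 : 0 < N n by near: n; exact: cvgry_gt expected_degree_cvgry 0.
have c0N_ge4 : 4 <= c0 * N n.
  rewrite mulrC -ler_pdivrMr//; near: n.
  exact: cvgry_ge expected_degree_cvgry (4 / c0).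
have M_ge : c0 ^+ 2 / 64 * N n ^+ 2 <= (M * M)%:R.
  rewrite natrM -expr2 (_ : _ * _ = (c0 * N n / 8) ^+ 2); last by field.
  have occ_ge : c0 * N n / 8 <= M%:R by exact: occupancy_ge.
  have occ0 : 0 <= c0 * N n / 8 by rewrite divr_ge0// mulr_ge0// ltW.
  by rewrite lerXn2r// nnegrE (le_trans occ0).
have N2_gt0 : 0 < N n ^+ 2 by rewrite exprn_gt0.
rewrite /light_bridges /bridge_rank; case: ifPn => [_|].
  rewrite /J /num_stages binSn subSnn expr1 ler_wpM2l// ler_expR lerN2 invf_div.
  apply: (@le_trans _ _ (c0 ^+ 2 / 64 * log_power kappa n)).
    by near: n; exact: near_ln_le_log_power.
  rewrite [leRHS]mulrAC ler_pdivlMr// mulrAC [leRHS]mulrC.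
  by rewrite ler_wpM2r ?powR_ge0.
rewrite -ltNge => kL; have L0 : 0 <= L n by rewrite (le_trans ler01)//; near: n.
have /andP[LJ _] := num_stages_bounds L0.
apply: (@le_trans _ _ (expR (- (c2 * J%:R)))).
  apply: le_trans (decay J); rewrite ler_wpM2l// lerXn2r ?nnegrE ?expR_ge0//.
  by rewrite ler_expR lerN2 [leRHS]mulrC ler_pdivlMr.
apply: (@le_trans _ _ (expR (- (G * ln n%:R)))); last first.
  by rewrite ler_peMl ?expR_ge0// ler1n.
rewrite ler_expR lerN2; apply: (@le_trans _ _ (c2 * log_power kappa n)).
  by near: n; exact: near_ln_le_log_power.
by rewrite ler_wpM2l ?(ltW c20)// ltW// (lt_trans kL).
Unshelve. all: by end_near. Qed.

End Regime.

Theorem theorem1 (R : realType)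
  (d : nat -> measure_display) (T : forall n, measurableType (d n))
  (P : forall n, probability (T n) R)
  (f : R * R -> R) (eps1 eps2 : R)
  (nu : probability R R)
  (X : forall n, 'I_n -> {RV (P n) >-> (R * R)%type})
  (W : forall n, {set vertex n} -> {RV (P n) >-> R})
  (r zeta : nat -> R) (beta c : R)
  (eps1_gt0 : 0 < eps1) (eps2_gt0 : 0 < eps2)
  (f_meas : measurable_fun unit_square f)
  (f_bounds : forall x, unit_square x -> eps1 <= f x <= eps2)
  (f_density :
    (\int[lebesgue_measure \x lebesgue_measure]_(x in unit_square) (f x)%:E
       = 1)%E)
  (X_law : forall n (i : 'I_n) (A : set (R * R)), measurable A ->
    (distribution (P n) (X n i) A
       = \int[lebesgue_measure \x lebesgue_measure]_(x in A `&` unit_square)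
           (f x)%:E)%E)
  (X_indep : forall n, mutually_independent (P n) [set: 'I_n]%SET
    (fun i => g_sigma_algebra_preimage (X n i)))
  (W_law : forall n e, e \in K2_edges n -> forall A : set R, measurable A ->
    distribution (P n) (W n e) A = nu A)
  (W_pos : forall n e, e \in K2_edges n ->
    {ae P n, forall t, 0 < W n e t})
  (W_indep : forall n, mutually_independent (P n) (K2_edges n)
    (fun e => g_sigma_algebra_preimage (W n e)))
  (XW_indep : forall n, independent_classes (P n)
    (sigma_of_family [set: 'I_n]%SET (fun i => X n i : T n -> R * R))
    (sigma_of_family (K2_edges n) (fun e => W n e : T n -> R)))
  (r_range : forall n, 0 < r n < 1)
  (zeta_range : forall n, 0 < zeta n < 2^-1)
  (beta_gt0 : 0 < beta) (beta_lt_c : beta < c) (c_lt_half : c < 2^-1)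
  (r_lower : \forall n \near \oo, (n%:R `^ beta)^-1 <= r n)
  (L_lower : \forall n \near \oo, 1 <= zeta n / r n)
  (H_incr : exists z0 : R, forall z1 z2 : R, z0 <= z1 -> z1 < z2 ->
    inv_ccdf nu z1 < inv_ccdf nu z2) :
  forall gamma kappa : R, 0 < gamma -> 0 < kappa ->
  exists2 epsilon0 : R, 0 < epsilon0 < 1 &
  forall epsilon : R, 0 < epsilon < epsilon0 ->
  exists theta1 theta2 : R, [/\ 0 < theta1, 0 < theta2 &
    \forall n \near \oo,
      let L := zeta n / r n in
      let N := n%:R * r n ^+ 2 in
      let q := (n%:R `^ c)^-1 in
      let w := inv_ccdf nu (N `^ (1 - epsilon)) in
      let alpha := alpha_scale (inv_ccdf nu) kappa n N L in
      let M := fun t : T n =>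
        max_weight (r n) (location (zeta n) (fun i => X n i t))
          (fun e => W n e t) (theta1 * L) q w in
      ((1 - (n%:R `^ (1 + gamma))^-1)%:E
         <= P n [set t | (theta2 * L * alpha <= M t)%R])%E].
Proof.
move=> gamma kappa gamma_gt0 kappa_gt0; have [z0 H_mono] := H_incr.
exists 2^-1 => [|epsilon /andP[eps_gt0 eps_lt]]; first by lra.
pose K := (Num.truncn (2 / epsilon)).+1; pose c0 := mass_constant eps1 K.
have K_ge : 2 / epsilon <= K%:R by exact/ltW/truncnS_gt.
have c0_gt0 : 0 < c0 by rewrite divr_gt0// mulr_gt0// exprn_gt0.
have decay_base : 0 <= expR (- (c0 ^+ 2 / 64)) < 1.
  by rewrite expR_ge0 expR_lt1 oppr_lt0 divr_gt0// exprn_gt0.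
have [B [c2 [B_gt0 c2_gt0 decay]]] := binomial_tail_decay decay_base.
have r_gt0 n : 0 < r n by have /andP[] := r_range n.
have beta_lt_half : beta < 2^-1 by exact: lt_trans c_lt_half.
have zeta_lt n : zeta n < 2^-1 by have /andP[] := zeta_range n.
exists (3 * K.*2.+2%:R), B%:R^-1; split; rewrite ?mulr_gt0 ?invr_gt0 ?ltr0n//.
have f_ge x : unit_square x -> eps1 <= f x by move=> /f_bounds/andP[].
near=> n; apply: (pr_max_weight_ge_scale (X_indep n) (W_law n) (W_indep n)
  (XW_indep n) eps1_gt0 f_meas f_ge (X_law n) (K := K) (z0 := z0)) => //;
  near: n.
- exact: L_lower.
- by apply: (near_min_length_le r_lower beta_lt_c); rewrite mulr_gt0.
- by apply: (near_rank_bounds _ beta_lt_half r_lower) => //; lra.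
- by apply: (near_growth_rates beta_lt_half r_lower) => //; lra.
- exact: (near_occupancy_tail beta_lt_half r_lower).
- exact: (near_bridge_tail beta_lt_half r_lower _ _ _ c2_gt0).
- exact: (near_total_failure r_gt0 zeta_lt beta_lt_half r_lower).
Unshelve. all: by end_near. Qed.
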